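(* Let $n\ge 1$. The rational Hamiltonians $$\Delta_{l;k}/\Delta'_{l;l-k}\ (1\le k<l\le n),\qquad \Delta_l\ (1\le l\le n)$$ on $(M_n,\pi_n)$ pairwise Poisson commute, and they induce integrable systems on the symplectic leaves of the open double Bruhat cell $\mathrm{GL}_n^{w^n_\circ,w^n_\circ}$, as follows: the $n$ Hamiltonians with $l=n$ are Casimirs for $(\mathrm{GL}_n^{w^n_\circ,w^n_\circ},\pi_n)$ and restrict to constants on each symplectic leaf; the remaining $n(n-1)/2$ Hamiltonians are functionally independent on every symplectic leaf of $\mathrm{GL}_n^{w^n_\circ,w^n_\circ}$; and every such leaf has dimension $n(n-1)$.
   Context: $M_n$ is the space of complex $n\times n$ matrices with coordinate functions $x_{ij}$, equipped with the quadratic Poisson structure $$\pi_n=\sum_{i,k=1}^n\sum_{j,l=1}^n(\mathrm{sign}(k-i)+\mathrm{sign}(l-j))\,x_{il}x_{kj}\,\frac{\partial}{\partial x_{ij}}\wedge\frac{\partial}{\partial x_{kl}},$$ where $\mathrm{sign}(a)=1,0,-1$ according to $a>0$, $a=0$, $a<0$; the bracket is normalized by $\{x_{ij},x_{kl}\}=(\mathrm{sign}(k-i)+\mathrm{sign}(l-j))x_{il}x_{kj}$ and extended to rational functions. For index sets $I,J$ with $|I|=|J|$, $\Delta_{I,J}(X)$ is the determinant of the submatrix of $X$ with rows $I$ and columns $J$; $[a,b]=\{a,a+1,\ldots,b\}$. For $1\le k<l\le n$ put $\Delta_{l;k}=\Delta_{[1,k],[l-k+1,l]}$ and $\Delta'_{l;k}=\Delta_{[l-k+1,l],[1,k]}$,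 and for $1\le l\le n$ put $\Delta_l=\Delta_{[1,l],[1,l]}$. $w^n_\circ$ is the longest element of $S_n$, identified with its permutation matrix; $B_+$ and $B_-$ are the subgroups of upper and lower triangular matrices in $\mathrm{GL}_n(\mathbb{C})$; and $\mathrm{GL}_n^{w^n_\circ,w^n_\circ}=B_+w^n_\circ B_+\cap B_-w^n_\circ B_-$, a Zariski open subset of $M_n$. Symplectic leaves are taken with respect to $\pi_n$, and dimensions are complex. Functions that are rational on $M_n$ are called functionally independent on a leaf if their restrictions to the leaf are defined, with linearly independent differentials, on a dense open subset of the leaf. *)

(* Defs.v *)
From Stdlib Require Import Relation_Operators.
From mathcomp Require Import all_boot all_order all_fingroup all_algebra.
From mathcomp Require Import all_classical all_reals all_analysis.
From mathcomp Require Import complex.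

Set Implicit Arguments.
Unset Strict Implicit.
Unset Printing Implicit Defensive.

Import Order.TTheory GRing.Theory Num.Theory.
Import numFieldNormedType.Exports.

Local Open Scope classical_set_scope.
Local Open Scope ring_scope.

(* The complex numbers R[i], bundled as a numClosedFieldType so that C and the
   matrix spaces over it inherit the topological and normed-module structures
   that the library attaches to numeric fields.  Differentiability over C is
   complex differentiability. *)
Definition C (R : realType) : numClosedFieldType := R[i].

Section Minors.
Variables (K : comNzRingType) (n : nat).

(* The interval [a, b] of 1-based indices. *)
Definition index_itv (a b : nat) : {set 'I_n} :=
  [set i : 'I_n | (a <= i.+1 <= b)%N]%SET.

(* Delta_{I,J}, for #|I| = #|J|; enum lists an index set increasingly, and the
   default value of nth is never used. *)
Definition minor (I J : {set 'I_n}) (X : 'M[K]_n) : K :=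
  \det (\matrix_(i < #|I|, j < #|I|)
          X (enum_val i) (nth (enum_val i) (enum J) j)).

Definition Delta (l k : nat) : 'M[K]_n -> K :=
  minor (index_itv 1 k) (index_itv (l - k + 1) l).

Definition Delta' (l k : nat) : 'M[K]_n -> K :=
  minor (index_itv (l - k + 1) l) (index_itv 1 k).

Definition lead_minor (l : nat) : 'M[K]_n -> K :=
  minor (index_itv 1 l) (index_itv 1 l).

End Minors.

Section Hamiltonians.
Variables (K : fieldType) (n : nat).

(* The pair (l, k) with 1 <= k < l indexes Delta_{l;k} / Delta'_{l;l-k}, and
   the pair (l, l) indexes Delta_l. *)
Definition ham (p : nat * nat) (X : 'M[K]_n) : K :=
  let: (l, k) := p in
  if (k < l)%N then Delta l k X / Delta' l (l - k) X else lead_minor l X.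

(* Where the rational function ham p is defined. *)
Definition ham_dom (p : nat * nat) : set 'M[K]_n :=
  [set X | let: (l, k) := p in (k < l)%N -> Delta' l (l - k) X != 0].

End Hamiltonians.

Definition ham_index (m : nat) : seq (nat * nat) :=
  [seq (l, k) | l <- iota 1 m, k <- iota 1 l].

Section Bruhat.
Variables (K : fieldType) (n : nat).

(* is_trig_mx means lower triangular. *)
Definition borel_minus : set 'M[K]_n :=
  [set b | is_trig_mx b /\ b \in unitmx].

Definition borel_plus : set 'M[K]_n :=
  [set b | is_trig_mx b^T /\ b \in unitmx].

(* The longest element of S_n reverses the order of the indices. *)
Definition w0 : 'S_n := perm (@rev_ord_inj n).

Definition double_coset (B : set 'M[K]_n) : set 'M[K]_n :=
  [set X | exists b1 b2, [/\ B b1, B b2 & X = b1 *m perm_mx w0 *m b2]].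

Definition open_double_bruhat_cell : set 'M[K]_n :=
  double_coset borel_plus `&` double_coset borel_minus.

End Bruhat.

Section Poisson.
Variables (R : realType) (n : nat).
Local Notation C := (C R).
Local Notation M := 'M[C]_n.

Definition holomorphic_near (X : M) (f : M -> C) : Prop :=
  \forall Y \near X, differentiable f Y.

Definition sign (a : int) : C := (sgz a)%:~R.

(* The partial derivative with respect to x_ij is the directional derivative
   along delta_mx i j.  On rational functions this is the biderivation that
   extends the bracket of the coordinate functions. *)
Definition bracket (f g : M -> C) (X : M) : C :=
  \sum_(i < n) \sum_(k < n) \sum_(j < n) \sum_(l < n)
    (sign (k%:Z - i%:Z) + sign (l%:Z - j%:Z)) * X i l * X k j
    * 'D_(delta_mx i j) f X * 'D_(delta_mx k l) g X.

Definition casimir (P : set M) (f : M -> C) : Prop :=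
  forall X, P X -> holomorphic_near X f /\
    forall g, holomorphic_near X g -> bracket f g X = 0.

Definition hamiltonian_vector (f : M -> C) (X : M) : M :=
  \matrix_(k, l) bracket f (fun Y : M => Y k l) X.

(* The characteristic distribution, i.e. the image of the map from covectors
   to vectors defined by the Poisson tensor. *)
Definition characteristic (X : M) : set M :=
  [set v | exists2 f, holomorphic_near X f & v = hamiltonian_vector f X].

(* phi parametrizes, by the connected open subset V of C^d, an injectively
   immersed integral manifold of the characteristic distribution contained in
   the open Poisson submanifold P. *)
Definition integral_chart (P : set M) (d : nat) (V : set 'rV[C]_d)
    (phi : 'rV[C]_d -> M) : Prop :=
  [/\ open V, connected V, phi @` V `<=` P, {in V &, injective phi}
    & forall v, V v ->
        [/\ differentiable phi v, injective ('d phi v)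
          & range ('d phi v) = characteristic (phi v)]].

Definition in_common_chart (P : set M) (X Y : M) : Prop :=
  exists d V phi, [/\ @integral_chart P d V phi, (phi @` V) X & (phi @` V) Y].

(* Symplectic leaves are the maximal connected integral manifolds of the
   characteristic distribution: two points lie on the same leaf when a finite
   chain of connected integral manifolds joins them. *)
Definition symplectic_leaf (P L : set M) : Prop :=
  exists2 X, P X & L = [set Y | clos_refl_sym_trans M (in_common_chart P) X Y].

(* The manifold structure of a leaf L: its charts are the integral charts with
   values in L.  The topology and dimension of L are read in these charts, so
   L is treated as an immersed submanifold, not as a topological subspace. *)
Definition leaf_chart (P L : set M) (d : nat) (V : set 'rV[C]_d)
    (phi : 'rV[C]_d -> M) : Prop :=
  integral_chart P V phi /\ phi @` V `<=` L.

Definition leaf_dim (P L : set M) (d : nat) : Prop :=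
  forall X, L X -> exists V phi, @leaf_chart P L d V phi /\ (phi @` V) X.

Definition leaf_open (P L O : set M) : Prop :=
  O `<=` L /\
  forall d V phi, @leaf_chart P L d V phi -> open (V `&` phi @^-1` O).

Definition leaf_dense (P L O : set M) : Prop :=
  forall d V phi, @leaf_chart P L d V phi ->
  forall W, open W -> W `<=` V -> W !=set0 -> W `&` phi @^-1` O !=set0.

(* The restrictions to L of the functions F p, for p in the duplicate-free
   list s, have linearly independent differentials at X. *)
Definition independent_at (P L : set M) (I : eqType) (s : seq I)
    (F : I -> M -> C) (X : M) : Prop :=
  forall d V phi v, @leaf_chart P L d V phi -> V v -> phi v = X ->
    (forall p, p \in s -> differentiable (F p \o phi) v) /\
    forall c : I -> C,
      (forall w, \sum_(p <- s) c p * 'd (F p \o phi) v w = 0) ->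
      forall p, p \in s -> c p = 0.

Definition functionally_independent (P L : set M) (I : eqType) (s : seq I)
    (dom : I -> set M) (F : I -> M -> C) : Prop :=
  exists O, [/\ leaf_open P L O, leaf_dense P L O
    & forall X, O X ->
        (forall p, p \in s -> dom p X) /\ independent_at P L s F X].

End Poisson.

(* Main.v *)
Require Import Defs.
From HB Require Import structures.
From Stdlib Require Import Relation_Operators.
From mathcomp Require Import all_boot all_order all_algebra perm.
From mathcomp Require Import all_classical all_reals all_analysis.
From mathcomp Require Import complex zify ring.

Set Implicit Arguments.
Unset Strict Implicit.
Unset Printing Implicit Defensive.

Import Order.TTheory GRing.Theory Num.Theory.
Import numFieldNormedType.Exports.

Local Open Scope classical_set_scope.
Local Open Scope ring_scope.

(* Write H(l,k) = N(l,k) / D(l,k) for the quotient of the solid minor of size k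
   in the first k rows and columns l-k+1..l by the one of size l-k in rows
   k+1..l and the first l-k columns; D(l,l) = 1.

   If the row sets of two minors satisfy I \ I' < I' \ I and the column sets
   J' \ J < J \ J', then their bracket is (#(J & J') - #(I & I')) times their
   product.  This applies to all pairs of minors that occur in the
   Hamiltonians, and to an entry of X against N(n,k) and D(n,k); commutation
   and the Casimir property become identities between cardinalities.

   The cell is the locus where X and X^T lie in B_- w0 B_-, i.e. where all
   N(n,k) and D(n,k) are nonzero.  There, a covector A that is killed by the
   Poisson tensor and such that A X has zero diagonal vanishes, by comparing
   triangular matrices in X = b1 w0 b2; hence the characteristic distribution
   is exactly the common kernel of the n Casimir differentials, of dimension
   n(n-1).  A chart of the leaf through X0 is obtained by fixing one nonzero
   entry in each row of X0, moving the others, and multiplying from the left by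
   a diagonal matrix that restores the values of the Casimirs; this requires
   only a holomorphic square root near 1.

   Where all initial minors are nonzero, the differentials of all H(l,k) are
   independent, because they are triangular in the position of the bottom right
   corner; on the leaf one divides by the Casimir differentials.  This locus is
   dense in each leaf: if the block of an initial minor were singular on an open
   subset of a leaf, with kernel vectors xi and eta at a point of maximal rank,
   all tangent vectors v would satisfy xi v eta = 0, which is impossible for
   v = hamvec X (E_ji) with suitable i and j. *)

(** * The Poisson tensor and brackets of minors *)

Section PoissonTensor.
Variables (K : comUnitRingType) (n : nat).
Implicit Types (X A B P Q : 'M[K]_n).

Definition nsign (a b : nat) : K := (a < b)%N%:R - (b < a)%N%:R.

(** The skew part of the standard r-matrix of $\mathfrak{gl}_n$: the strictly lower part of [P]
    minus its strictly upper part. With it the quadratic structure takes the Sklyanin form below. *)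
Definition sg P : 'M[K]_n := \matrix_(i, j) (nsign j i * P i j).

(* A matrix A stands for the covector v |-> tr (A *m v): hamvec X is the map
   from covectors to vectors at X, and pb X the Poisson tensor. *)
Definition hamvec X A : 'M[K]_n := sg (X *m A) *m X - X *m sg (A *m X).

Definition pb X A B : K :=
  \tr (sg (X *m A) *m (X *m B)) - \tr (sg (A *m X) *m (B *m X)).

Lemma nsignC a b : nsign b a = - nsign a b.
Proof. by rewrite /nsign opprB. Qed.

Lemma pb_hamvec X A B : pb X A B = \tr (B *m hamvec X A).
Proof.
rewrite /pb /hamvec mulmxBr raddfB /=; congr (_ - _).
  by rewrite !mulmxA mxtrace_mulC mulmxA.
by rewrite mxtrace_mulC mulmxA.
Qed.

Lemma mxtrace_sg P Q : \tr (sg P *m Q) = - \tr (sg Q *m P).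
Proof.
rewrite /mxtrace -sumrN.
under eq_bigr do rewrite mxE.
under [RHS]eq_bigr do rewrite mxE -sumrN.
rewrite exchange_big /=; apply: eq_bigr => i _; apply: eq_bigr => j _.
by rewrite !mxE nsignC; ring.
Qed.

Lemma pbC X A B : pb X A B = - pb X B A.
Proof. by rewrite /pb mxtrace_sg [X in _ - X]mxtrace_sg opprB opprK addrC. Qed.

Fact sg_is_linear : linear sg.
Proof. by move=> a P Q; apply/matrixP=> i j; rewrite !mxE; ring. Qed.
HB.instance Definition _ :=
  GRing.isLinear.Build K 'M[K]_n 'M[K]_n *:%R sg sg_is_linear.

Fact hamvec_is_linear X : linear (hamvec X).
Proof.
have H (a : K) (A B : 'M[K]_n) :
    hamvec X (a *: A + B) = a *: hamvec X A + hamvec X B.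
  rewrite /hamvec mulmxDr mulmxDl -scalemxAr -scalemxAl !linearP /=.
  by rewrite mulmxDl -scalemxAl scalerBr scalerN addrACA.
exact: H.
Qed.
HB.instance Definition _ X :=
  GRing.isLinear.Build K 'M[K]_n 'M[K]_n *:%R (hamvec X) (hamvec_is_linear X).

Lemma pbD X A B B' : pb X A (B + B') = pb X A B + pb X A B'.
Proof. by rewrite !pb_hamvec mulmxDl raddfD. Qed.
Lemma pbZ X A a B : pb X A (a *: B) = a * pb X A B.
Proof. by rewrite !pb_hamvec -scalemxAl mxtraceZ. Qed.
Lemma pbDl X A B B' : pb X (B + B') A = pb X B A + pb X B' A.
Proof. by rewrite pbC pbD opprD -!pbC. Qed.
Lemma pbZl X A a B : pb X (a *: B) A = a * pb X B A.
Proof. by rewrite pbC pbZ -mulrN -pbC. Qed.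

(* The two identities satisfied by the differential A of a minor f with rows I
   and columns J: X *m A collects the derivatives of f along row operations and
   A *m X those along column operations. *)
Definition minor_like (I J : pred 'I_n) (f : K) X A : Prop :=
  [/\ forall k i, ~~ I i -> (X *m A) k i = 0,
      forall k i, I k -> (X *m A) k i = f *+ (k == i),
      forall j l, ~~ J j -> (A *m X) j l = 0
    & forall j l, J l -> (A *m X) j l = f *+ (j == l)].

Definition before (I J : pred 'I_n) : Prop :=
  forall i k, I i -> ~~ J i -> J k -> ~~ I k -> (i < k)%N.

(** In $\mathrm{tr}(\mathrm{sg}(XA)\,XA')$ only the diagonal terms with index in $I\cap I'$ and the
    off-diagonal terms $(k,i)$ with $i\in I\setminus I'$, $k\in I'\setminus I$ can survive. For the
    latter [before] forces the sign 1, so replacing all signs by 1 only overcounts the diagonal.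
    Columns behave likewise, and the two unsigned traces cancel by cyclicity. *)
Lemma pb_minor_like X I J f A I' J' f' A' :
  minor_like I J f X A -> minor_like I' J' f' X A' ->
  before I I' -> before J' J ->
  pb X A A' = ((\sum_(j | J j && J' j) 1%N)%N%:R
               - (\sum_(i | I i && I' i) 1%N)%N%:R) * (f * f').
Proof.
move=> [r0 r1 c0 c1] [r0' r1' c0' c1'] II' J'J.
have row : \tr (sg (X *m A) *m (X *m A')) =
    \tr (X *m A *m (X *m A')) - (\sum_(i | I i && I' i) 1%N)%N%:R * (f * f').
  rewrite natr_sum mulr_suml /mxtrace [X in _ - X]big_mkcond -sumrB.
  apply: eq_bigr => k _; rewrite mxE [X in X - _]mxE.
  transitivity (\sum_j ((X *m A) k j * (X *m A') j k
                 - (if (k == j) && (I k && I' k) then f * f' else 0))); last first.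
    rewrite sumrB; congr (_ - _); rewrite (bigD1 k) //= eqxx /= big1 ?addr0 ?mul1r//.
    by move=> i /negPf; rewrite eq_sym => ->.
  apply: eq_bigr => i _; rewrite mxE /nsign.
  case: (boolP (I i)) => Ii; last first.
    by rewrite r0//; case: eqP => [->|_]; rewrite ?(negPf Ii) /=; ring.
  case: (boolP (I' k)) => I'k; last first.
    by rewrite r0'// andbF /= andbF; ring.
  have [ki|nki] := eqVneq k i.
    subst i; rewrite r1// r1'// Ii eqxx ltnn /=; ring.
  rewrite /= subr0.
  case: (boolP (I k)) => Ik; first by rewrite r1// ?(negPf nki) mulr0n; ring.
  case: (boolP (I' i)) => I'i.
    by rewrite (r1' i)// eq_sym (negPf nki) mulr0n; ring.
  have lik := II' _ _ Ii I'i I'k Ik.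
  by rewrite lik ltnNge (ltnW lik) /=; ring.
have col : \tr (sg (A *m X) *m (A' *m X)) =
    \tr (A *m X *m (A' *m X)) - (\sum_(i | J i && J' i) 1%N)%N%:R * (f * f').
  rewrite natr_sum mulr_suml /mxtrace [X in _ - X]big_mkcond -sumrB.
  apply: eq_bigr => j _; rewrite mxE [X in X - _]mxE.
  transitivity (\sum_l ((A *m X) j l * (A' *m X) l j
                 - (if (j == l) && (J j && J' j) then f * f' else 0))); last first.
    rewrite sumrB; congr (_ - _); rewrite (bigD1 j) //= eqxx /= big1 ?addr0 ?mul1r//.
    by move=> i /negPf; rewrite eq_sym => ->.
  apply: eq_bigr => l _; rewrite mxE /nsign.
  case: (boolP (J j)) => Jj; last first.
    by rewrite c0// /= andbF; ring.
  case: (boolP (J' l)) => J'l; last first.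
    by rewrite (c0' l)//; case: eqP => [->|_]; rewrite ?(negPf J'l) /= ?andbF; ring.
  have [jl|njl] := eqVneq j l.
    subst l; rewrite c1// c1'// J'l eqxx ltnn /=; ring.
  rewrite /= subr0.
  case: (boolP (J l)) => Jl; first by rewrite c1// (negPf njl) mulr0n; ring.
  case: (boolP (J' j)) => J'j.
    by rewrite (c1' l)// eq_sym (negPf njl) mulr0n; ring.
  have lik := J'J _ _ J'l Jl Jj J'j.
  by rewrite lik ltnNge (ltnW lik) /=; ring.
rewrite /pb row col.
have -> : \tr (A *m X *m (A' *m X)) = \tr (X *m A *m (X *m A')).
  by rewrite [RHS]mxtrace_mulC !mulmxA [RHS]mxtrace_mulC !mulmxA.
by ring.
Qed.

End PoissonTensor.

(** * Solid minors and their log-canonical brackets *)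

Section SolidMinors.
Variables (K : comUnitRingType) (n' : nat).
Local Notation n := n'.+1.
Implicit Types (X A B : 'M[K]_n).

(** Jacobi's formula for the differential of a minor: the adjugate of the submatrix, put back into
    the $n\times n$ frame by the selection matrices. *)
Definition sub_cov m (r c : 'I_m -> 'I_n) X : 'M[K]_n :=
  colsub c 1%:M *m \adj (mxsub r c X) *m rowsub r 1%:M.

Lemma minor_like_sub m (r c : 'I_m -> 'I_n) X :
  minor_like (mem (codom r)) (mem (codom c)) (\det (mxsub r c X)) X
    (sub_cov r c X).
Proof.
have E : mxsub r c X = rowsub r 1%:M *m X *m colsub c 1%:M.
  by rewrite mul_rowsub_mx mul1mx mulmx_colsub mulmx1; apply/matrixP=> i j; rewrite !mxE.
have EX : rowsub r 1%:M *m X *m sub_cov r c X = \det (mxsub r c X) *: rowsub r 1%:M.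
  by rewrite /sub_cov !mulmxA -E mul_mx_adj mul_scalar_mx.
have EX' : sub_cov r c X *m (X *m colsub c 1%:M) = \det (mxsub r c X) *: colsub c 1%:M.
  by rewrite /sub_cov -!mulmxA [rowsub _ _ *m _]mulmxA -E mul_adj_mx mul_mx_scalar.
split.
- move=> k i ni; rewrite /sub_cov mulmxA mxE big1 // => j _.
  rewrite !mxE; case: eqP => [e|]; rewrite ?mulr0//.
  by move: ni; rewrite /= -e codom_f.
- move=> k i /= /codomP[a ->].
  move/matrixP: EX => /(_ a i); rewrite -mulmxA.
  rewrite mul_rowsub_mx mul1mx !mxE => ->.
  by rewrite mulr_natr.
- move=> j l nj; rewrite /sub_cov -2!mulmxA mxE big1 // => i _.
  rewrite !mxE; case: eqP => [e|]; rewrite ?mul0r//.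
  by move: nj; rewrite /= e codom_f.
- move=> j l /= /codomP[a ->].
  move/matrixP: EX' => /(_ j a); rewrite mulmxA.
  rewrite mulmx_colsub mulmx1 !mxE => ->.
  by rewrite mulr_natr.
Qed.

Lemma minor_like_eq I I' J J' f X A : I =1 I' -> J =1 J' ->
  minor_like I J f X A -> minor_like I' J' f X A.
Proof.
move=> eI eJ [h1 h2 h3 h4].
by split=> *; [apply: h1 | apply: h2 | apply: h3 | apply: h4]; rewrite ?eI ?eJ.
Qed.

Lemma minor_like_entry (i j : 'I_n) X :
  minor_like (pred1 i) (pred1 j) (X i j) X (delta_mx j i).
Proof.
split=> a b /=.
- move=> /negPf ni; rewrite mxE big1 // => k _; rewrite !mxE.
  by rewrite ni andbF mulr0.
- move=> /eqP->; rewrite mxE (bigD1 j) //= big1 ?addr0 => [|k /negPf nk].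
    by rewrite !mxE eqxx mulr_natr eq_sym.
  by rewrite !mxE nk mulr0.
- move=> /negPf na; rewrite mxE big1 // => k _; rewrite !mxE.
  by rewrite na mul0r.
- move=> /eqP->; rewrite mxE (bigD1 i) //= big1 ?addr0 => [|k /negPf nk].
    by rewrite !mxE eqxx andbT mulr_natl.
  by rewrite !mxE nk andbF mul0r.
Qed.

Definition shift_ord m p (i : 'I_m) : 'I_n := inord (p + i).

Lemma val_shift_ord m p (i : 'I_m) : (p + m <= n)%N ->
  shift_ord p i = (p + i)%N :> nat.
Proof. by move=> pm; rewrite inordK //; have := ltn_ord i; lia. Qed.

(* The minor of size m with contiguous rows and columns, starting at the
   0-based indices p and q. *)
Definition solid p q m X : K := \det (mxsub (@shift_ord m p) (@shift_ord m q) X).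

Definition solid_cov p q m X := sub_cov (@shift_ord m p) (@shift_ord m q) X.

Definition itv p q : pred 'I_n := fun i => (p <= i < q)%N.

Lemma codom_shift m p : (p + m <= n)%N ->
  mem (codom (@shift_ord m p)) =1 itv p (p + m).
Proof.
move=> pm i /=; rewrite /itv; apply/codomP/andP => [[a ->]|[pi ip]].
  have am := ltn_ord a.
  rewrite inordK; lia.
have lt : (i - p < m)%N by lia.
by exists (Ordinal lt); apply: ord_inj; rewrite inordK /=; lia.
Qed.

Lemma minor_like_solid p q m X : (p + m <= n)%N -> (q + m <= n)%N ->
  minor_like (itv p (p + m)) (itv q (q + m)) (solid p q m X) X (solid_cov p q m X).
Proof.
by move=> *; apply: minor_like_eq (minor_like_sub _ _ _); exact: codom_shift.
Qed.

Lemma sum_itv a b : (b <= n)%N -> (\sum_(i | itv a b i) 1 = b - a)%N.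
Proof.
move=> bn; rewrite -(big_mkord (fun i => (a <= i < b)%N) (fun=> 1%N)).
rewrite (@big_cat_nat _ _ _ b) //= [X in (_ + X)%N]big1_seq => [|i]; last first.
  by rewrite mem_index_iota; lia.
rewrite addn0 sum1_count.
elim: b bn => [|b IH] bn; first by rewrite /index_iota.
rewrite /index_iota subn0 -addn1 iotaD count_cat /= addn0 add0n.
have -> : count (fun i => (a <= i < b + 1)%N) (iota 0 b) =
          count (fun i => (a <= i < b)%N) (iota 0 b).
  by apply: eq_in_count => i; rewrite mem_iota; lia.
by move: (IH (ltnW bn)); rewrite /index_iota subn0 => ->; lia.
Qed.

Lemma sum_itvI a b c d : (b <= n)%N -> (d <= n)%N ->
  (\sum_(i | itv a b i && itv c d i) 1 = minn b d - maxn a c)%N.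
Proof.
move=> bn dn; rewrite -sum_itv; last by lia.
by apply: eq_bigl => i; rewrite /itv; lia.
Qed.

Lemma pb_solid p q m p' q' m' X :
  (p + m <= n)%N -> (q + m <= n)%N -> (p' + m' <= n)%N -> (q' + m' <= n)%N ->
  before (itv p (p + m)) (itv p' (p' + m')) ->
  before (itv q' (q' + m')) (itv q (q + m)) ->
  pb X (solid_cov p q m X) (solid_cov p' q' m' X) =
  ((minn (q + m) (q' + m') - maxn q q')%N%:R
   - (minn (p + m) (p' + m') - maxn p p')%N%:R)
  * (solid p q m X * solid p' q' m' X).
Proof.
move=> h1 h2 h3 h4 b1 b2.
rewrite (pb_minor_like (minor_like_solid X h1 h2) (minor_like_solid X h3 h4) b1 b2).
by rewrite !sum_itvI.
Qed.

Definition ham_num l k := solid 0 (l - k) k.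
Definition ham_den l k := solid k 0 (l - k).

(** The quotient rule; [cov_ham_val] identifies this with the differential of [ham_val]. *)
Definition ham_cov l k X : 'M[K]_n :=
  (ham_den l k X ^+ 2)^-1 *: (ham_den l k X *: solid_cov 0 (l - k) k X
                     - ham_num l k X *: solid_cov k 0 (l - k) X).

(** The bracket of two Hamiltonians is a multiple of a signed sum of overlap lengths between the row
    and column intervals of their four minors. This identity makes that sum vanish. *)
Lemma solid_degrees_balance l k m p a b : (l <= m)%N -> l = (a + k)%N -> m = (b + p)%N ->
  (minn p k - maxn 0 0 + (minn k m - maxn 0 p) + (minn m a - maxn b 0)
     + (minn a b - maxn 0 0) =
   minn m l - maxn b a + (minn l b - maxn a 0) + (minn p l - maxn 0 k)
     + (minn l m - maxn k p))%N.
Proof.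
move=> lm el em; rewrite (minn_idPl lm) (minn_idPr lm) !max0n !maxn0.
have -> : minn k m = k by lia.
have -> : minn m a = a by lia.
case: (leqP k p) => kp; case: (leqP a b) => ab; case: (leqP l b) => lb;
  case: (leqP p l) => pl; lia.
Qed.

Lemma pb_ham_cov l k m p X : (k <= l)%N -> (p <= m)%N -> (l <= m <= n)%N ->
  pb X (ham_cov l k X) (ham_cov m p X) = 0.
Proof.
move=> kl pm /andP[lm mn].
have lkl : (0 + (l - k) <= n)%N by lia.
(* For each of the four pairs the order of the two minors is chosen so that [before] holds, using
   $l\le m$; the numerator of $(m,p)$ comes first in its two pairs with minors of $(l,k)$, and [pbC]
   restores the original order later. *)
have Bnn : before (itv 0 (0 + p)) (itv 0 (0 + k)) /\
           before (itv (l - k) (l - k + k)) (itv (m - p) (m - p + p)).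
  by split=> i j; rewrite /itv; lia.
have Bdd : before (itv k (k + (l - k))) (itv p (p + (m - p))) /\
           before (itv 0 (0 + (m - p))) (itv 0 (0 + (l - k))).
  by split=> i j; rewrite /itv; lia.
have Bnd : before (itv 0 (0 + k)) (itv p (p + (m - p))) /\
           before (itv 0 (0 + (m - p))) (itv (l - k) (l - k + k)).
  by split=> i j; rewrite /itv; lia.
have Bdn : before (itv 0 (0 + p)) (itv k (k + (l - k))) /\
           before (itv 0 (0 + (l - k))) (itv (m - p) (m - p + p)).
  by split=> i j; rewrite /itv; lia.
have nn := @pb_solid 0 (m - p) p 0 (l - k) k X ltac:(lia) ltac:(lia) ltac:(lia)
  ltac:(lia) Bnn.1 Bnn.2.
have dd := @pb_solid k 0 (l - k) p 0 (m - p) X ltac:(lia) ltac:(lia) ltac:(lia)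
  ltac:(lia) Bdd.1 Bdd.2.
have nd := @pb_solid 0 (l - k) k p 0 (m - p) X ltac:(lia) ltac:(lia) ltac:(lia)
  ltac:(lia) Bnd.1 Bnd.2.
have dn := @pb_solid 0 (m - p) p k 0 (l - k) X ltac:(lia) ltac:(lia) ltac:(lia)
  ltac:(lia) Bdn.1 Bdn.2.
rewrite /ham_cov pbZl pbZ !(pbDl, pbD, pbZ, pbZl) -!scaleNr !(pbZ, pbZl).
rewrite (pbC X (solid_cov 0 (l - k) k X)) nn dd nd.
rewrite (pbC X (solid_cov k 0 (l - k) X)) dn /ham_num /ham_den.
set A1 := (minn _ _ - _)%N; set B1 := (minn _ _ - _)%N.
set A2 := (minn _ _ - _)%N; set B2 := (minn _ _ - _)%N.
set A3 := (minn _ _ - _)%N; set B3 := (minn _ _ - _)%N.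
set A4 := (minn _ _ - _)%N; set B4 := (minn _ _ - _)%N.
have /(congr1 (fun i => i%:R : K)) : (B1 + B2 + A3 + A4 = A1 + A2 + B3 + B4)%N.
  rewrite /A1 /A2 /A3 /A4 /B1 /B2 /B3 /B4 !add0n.
  rewrite !(subnK kl, subnK pm, subnKC kl, subnKC pm).
  by apply: solid_degrees_balance; rewrite ?subnK.
rewrite !natrD => /eqP; rewrite -subr_eq0 => /eqP E.
set N := solid 0 (l - k) k X; set N' := solid 0 (m - p) p X.
set D := solid k 0 (l - k) X; set D' := solid p 0 (m - p) X.
transitivity (D ^- 2 * D' ^- 2 * (N * N' * D * D') * (B1%:R + B2%:R + A3%:R + A4%:R -
     (A1%:R + A2%:R + B3%:R + B4%:R))); last by rewrite E mulr0.
by ring.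
Qed.

(** For $l=n$ the row intervals of numerator and denominator partition all rows, and their column
    intervals all columns. Any entry of $X$ meets exactly one of each, so the row and column
    contributions cancel. *)
Lemma pb_casimir k i j X : (k <= n)%N ->
  pb X (ham_cov n k X) (delta_mx i j) = 0.
Proof.
move=> kn.
have Mx := minor_like_entry j i X.
have bn : before (itv 0 (0 + k)) (pred1 j) /\ before (pred1 i) (itv (n - k) (n - k + k)).
  by split=> a b; have := ltn_ord a; have := ltn_ord b; rewrite /itv; lia.
have bd : before (pred1 j) (itv k (k + (n - k))) /\ before (itv 0 (0 + (n - k))) (pred1 i).
  by split=> a b; have := ltn_ord a; have := ltn_ord b; rewrite /itv; lia.
have nn := pb_minor_like (@minor_like_solid 0 (n - k) k X ltac:(lia) ltac:(lia))
  Mx bn.1 bn.2.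
have dd := pb_minor_like Mx (@minor_like_solid k 0 (n - k) X ltac:(lia) ltac:(lia))
  bd.1 bd.2.
rewrite /ham_cov pbZl pbDl -scaleNr !pbZl nn (pbC X (solid_cov _ _ _ X)) dd.
have sum1 (P : pred 'I_n) (a : 'I_n) : (\sum_(j | P j && pred1 a j) 1 = P a)%N.
  by rewrite big_mkcondl big_pred1_eq; case: (P a).
have sum1' (P : pred 'I_n) (a : 'I_n) : (\sum_(j | pred1 a j && P j) 1 = P a)%N.
  by rewrite -(sum1 P); apply: eq_bigl => ?; rewrite andbC.
rewrite !sum1 !sum1' /ham_num /ham_den.
set A1 := nat_of_bool (itv (n - k) _ _); set B1 := nat_of_bool (itv 0 _ _).
set A2 := nat_of_bool (itv 0 (0 + (n - k)) _); set B2 := nat_of_bool (itv k _ _).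
have /(congr1 (fun i => i%:R : K)) : (A1 + A2 = B1 + B2)%N.
  rewrite /A1 /A2 /B1 /B2 /itv; have := ltn_ord i; have := ltn_ord j.
  by lia.
rewrite !natrD => /eqP; rewrite -subr_eq0 => /eqP E.
set N := solid 0 (n - k) k X; set D := solid k 0 (n - k) X.
transitivity (D ^- 2 * (N * D) * X j i * (A1%:R + A2%:R - (B1%:R + B2%:R))); last by rewrite E mulr0.
by ring.
Qed.

End SolidMinors.

(** * The open Bruhat cell *)

Section TriangularMatrices.
Variable (K : numFieldType).

Lemma is_trig_mx0 n (A : 'M[K]_n) (i j : 'I_n) :
  is_trig_mx A -> (i < j)%N -> A i j = 0.
Proof. by move=> /is_trig_mxP; apply. Qed.

Lemma is_trig_mxM n (A B : 'M[K]_n) :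
  is_trig_mx A -> is_trig_mx B -> is_trig_mx (A *m B).
Proof.
move=> /is_trig_mxP tA /is_trig_mxP tB; apply/is_trig_mxP => i j ij.
rewrite mxE big1 // => k _; case: (ltnP i k) => [/tA->|ki]; first by rewrite mul0r.
by rewrite tB ?mulr0// (leq_ltn_trans ki).
Qed.

Lemma is_trig_invmx n (A : 'M[K]_n) :
  is_trig_mx A -> A \in unitmx -> is_trig_mx (invmx A).
Proof.
move=> tA uA; have tA' i j := @is_trig_mx0 n A i j tA.
have dA i : A i i != 0.
  by move: uA; rewrite unitmxE det_trig// unitfE => /prodf_neq0; apply.
apply/is_trig_mxP => i.
elim/ltn_ind: {i}(nat_of_ord i) {-2}i (erefl (nat_of_ord i)) => m IH i im j ij.
have /matrixP/(_ i j) := mulmxV uA; rewrite !mxE.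
have -> : (i == j) = false by rewrite -val_eqE /=; lia.
rewrite (bigD1 i) //= big1 ?addr0 => [|k ki].
  by move=> /eqP; rewrite mulf_eq0 (negPf (dA i)) /= => /eqP.
case: (ltngtP k i) => [lt|gt|/ord_inj e]; last by rewrite e eqxx in ki.
  by rewrite [invmx A k j](IH k) ?mulr0//; lia.
by rewrite tA' ?mul0r.
Qed.

Definition rev_mx n : 'M[K]_n := \matrix_(i, j) (i == rev_ord j)%:R.

Lemma rev_mxK n : rev_mx n *m rev_mx n = 1%:M.
Proof.
apply/matrixP=> i j; rewrite !mxE (bigD1 (rev_ord i)) //= big1 => [|k nk].
  by rewrite !mxE rev_ordK eqxx mul1r addr0 (inj_eq rev_ord_inj).
rewrite !mxE; case: eqP => [e|]; last by rewrite mul0r.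
by rewrite e rev_ordK eqxx in nk.
Qed.

Lemma tr_rev_mx n : (rev_mx n)^T = rev_mx n.
Proof. by apply/matrixP=> i j; rewrite !mxE eq_sym (can2_eq rev_ordK rev_ordK). Qed.

Lemma mul_mx_rev n m (A : 'M[K]_(m, n)) i j : (A *m rev_mx n) i j = A i (rev_ord j).
Proof.
rewrite mxE (bigD1 (rev_ord j)) //= big1 => [|k nk].
  by rewrite mxE eqxx mulr1 addr0.
by rewrite mxE (negPf nk) mulr0.
Qed.

Lemma mul_rev_mx n m (A : 'M[K]_(n, m)) i j : (rev_mx n *m A) i j = A (rev_ord i) j.
Proof.
rewrite mxE (bigD1 (rev_ord i)) //= big1 => [|k nk].
  by rewrite mxE rev_ordK eqxx mul1r addr0.
rewrite mxE; case: eqP => [e|]; last by rewrite mul0r.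
by rewrite e rev_ordK eqxx in nk.
Qed.

Lemma unitmx_rev n : rev_mx n \in unitmx.
Proof. by case: (mulmx1_unit (rev_mxK n)). Qed.

(** The coset $B_-w_\circ B_-$. Since transposition exchanges the two Borel subgroups and fixes
    $w_\circ$, the cell is given by this condition on both $X$ and $X^T$. *)
Definition bruhat_minus n (X : 'M[K]_n) : Prop :=
  exists b1 b2, [/\ is_trig_mx b1, b1 \in unitmx, is_trig_mx b2, b2 \in unitmx
    & X = b1 *m rev_mx n *m b2].

Lemma bruhat_minus_unit n (X : 'M[K]_n) : bruhat_minus X -> X \in unitmx.
Proof.
by move=> [b1 [b2 [_ u1 _ u2 ->]]]; rewrite !unitmx_mul u1 u2 unitmx_rev.
Qed.

(** Transposition changes the sign of [sg] and exchanges the left and right terms of [hamvec]; the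
    two changes compensate. Results on $X$ thus pass to $X^T$. *)
Lemma tr_hamvec n (X A : 'M[K]_n) : hamvec X^T A^T = (hamvec X A)^T.
Proof.
have sgT (P : 'M[K]_n) : sg P^T = - (sg P)^T.
  by apply/matrixP=> i j; rewrite !mxE nsignC mulNr.
by rewrite /hamvec -!trmx_mul !sgT !raddfB /= !trmx_mul mulNmx mulmxN opprK addrC.
Qed.

(** The matrices $U=XA+\mathrm{sg}(XA)$ and $U'=AX+\mathrm{sg}(AX)$ are lower triangular, $U'$ even
    strictly, and the kernel condition gives $UX=XU'$. Writing $X=b_1w_\circ b_2$ turns this into
    $Bw_\circ=w_\circ B'$ with $B$ lower and $B'$ strictly lower triangular. Conjugation by
    $w_\circ$ makes $B$ upper triangular, so $B'=0$. *)
Lemma hamvec_ker_lower n (X A : 'M[K]_n) : bruhat_minus X ->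
  hamvec X A = 0 -> (forall i, (A *m X) i i = 0) ->
  A *m X + sg (A *m X) = 0 /\ X *m A + sg (X *m A) = 0.
Proof.
move=> BX; have uX := bruhat_minus_unit BX.
move: BX => [b1 [b2 [t1 u1 t2 u2 EX]]] /eqP; rewrite subr_eq0 => /eqP h0 d0.
have trigD (P : 'M[K]_n) : is_trig_mx (P + sg P).
  apply/is_trig_mxP => i j ij; rewrite !mxE /nsign ij.
  by rewrite ltnNge (ltnW ij) /=; ring.
set U := X *m A + sg (X *m A); set U' := A *m X + sg (A *m X).
have UX : U *m X = X *m U' by rewrite /U mulmxDl h0 /U' mulmxDr !mulmxA.
suff U'0 : U' = 0.
  split=> //; apply: (can_inj (mulmxK uX)).
  by rewrite UX U'0 mulmx0 mul0mx.
set B := invmx b1 *m U *m b1; set B' := b2 *m U' *m invmx b2.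
have BB' : B *m rev_mx n = rev_mx n *m B'.
  apply: (can_inj (mulKmx u1)); apply: (can_inj (mulmxK u2)).
  rewrite /B /B' !mulmxA mulmxV// mul1mx mulmxKV// -EX.
  by rewrite -UX EX !mulmxA.
have tB : is_trig_mx B by rewrite !is_trig_mxM ?is_trig_invmx ?trigD.
have B'0 (i j : 'I_n) : (i <= j)%N -> B' i j = 0.
  have t2' := is_trig_invmx t2 u2.
  move=> ij; rewrite mxE big1 // => k _.
  case: (ltnP k j) => [kj|jk]; first by rewrite (is_trig_mx0 t2') ?mulr0.
  rewrite mxE big1 ?mul0r // => l _.
  case: (ltnP i l) => [il|li]; first by rewrite (is_trig_mx0 t2) ?mul0r.
  case: (ltnP l k) => [lk|kl]; first by rewrite (is_trig_mx0 (trigD _)) ?mulr0.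
  have -> : l = k by apply: ord_inj; lia.
  have -> : U' k k = 0 by rewrite mxE d0 [sg _ _ _]mxE d0 mulr0 addr0.
  by rewrite mulr0.
have : B' = 0.
  apply/matrixP=> i j; rewrite [RHS]mxE; case: (leqP i j) => [/B'0//|ji].
  move/matrixP: BB' => /(_ (rev_ord i) j); rewrite mul_mx_rev mul_rev_mx rev_ordK => <-.
  by apply: (is_trig_mx0 tB) => /=; have := ltn_ord i; lia.
move=> E; apply: (can_inj (mulKmx u2)); apply: (can_inj (mulmxK (_ : invmx b2 \in unitmx))).
  by rewrite unitmx_inv.
by rewrite mulmx0 mul0mx -E.
Qed.

(** The previous lemma leaves $XA$ strictly upper triangular. Its zero diagonal is the hypothesis
    needed to apply that lemma to $X^T$ and $A^T$, which makes $XA$ strictly lower triangular as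
    well. *)
Lemma hamvec_ker n (X A : 'M[K]_n) : bruhat_minus X -> bruhat_minus X^T ->
  hamvec X A = 0 -> (forall i, (A *m X) i i = 0) -> A = 0.
Proof.
move=> BX BXT h0 d0; have uX := bruhat_minus_unit BX.
have [Q0 P0] := hamvec_ker_lower BX h0 d0.
have dP i : (X *m A) i i = 0.
  by move/matrixP: P0 => /(_ i i); rewrite !mxE /nsign ltnn subrr mul0r addr0.
have h0T : hamvec X^T A^T = 0 by rewrite tr_hamvec h0 trmx0.
have [i|PT0 _] := hamvec_ker_lower BXT h0T; first by rewrite -trmx_mul mxE dP.
apply: (can_inj (mulKmx uX)); rewrite mulmx0.
have lower0 (P : 'M[K]_n) (i j : 'I_n) : P + sg P = 0 -> (j <= i)%N -> P i j = 0.
  move=> /matrixP/(_ i j); rewrite !mxE /nsign => PE; rewrite leq_eqVlt => /orP[/eqP ji|ji].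
    by move: PE; rewrite ji ltnn subrr mul0r addr0.
  move: PE; rewrite ji ltnNge (ltnW ji) subr0 mul1r -mulr2n => /eqP.
  by rewrite mulrn_eq0 => /eqP.
apply/matrixP=> i j; rewrite [RHS]mxE.
case: (leqP j i) => [|/ltnW] ij; first exact: lower0.
by have := lower0 _ j i PT0 ij; rewrite -trmx_mul mxE.
Qed.

End TriangularMatrices.

Section OpenCell.
Variables (K : numFieldType) (n' : nat).
Local Notation n := n'.+1.
Implicit Types (X A B : 'M[K]_n).

Lemma solid_tr p q m X : solid p q m X^T = solid q p m X.
Proof. by rewrite /solid -det_tr; congr (\det _); apply/matrixP=> i j; rewrite !mxE. Qed.

Lemma solid0 p q X : solid p q 0 X = 1.
Proof. exact: det_mx00. Qed.

Lemma solid_full X : solid 0 0 n X = \det X.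
Proof.
congr (\det _); apply/matrixP=> i j.
by rewrite mxE /shift_ord !add0n !inord_val.
Qed.

Lemma row_trig_supp (c : 'M[K]_n) (v : 'rV[K]_n) k : is_trig_mx c ->
  (forall j : 'I_n, (k <= j)%N -> v 0 j = 0) ->
  forall j : 'I_n, (k <= j)%N -> (v *m c) 0 j = 0.
Proof.
move=> tc v0 j kj; rewrite mxE big1 // => i _.
case: (ltnP i j) => [ij|ji]; first by rewrite (is_trig_mx0 tc)// mulr0.
by rewrite v0 ?mul0r// (leq_trans kj).
Qed.

(** Lower triangular factors on the right preserve support in an initial segment of columns. Hence
    $vb_1w_\circ=vXb_2^{-1}$ is supported both in the last $k$ and in the first $n-k$ columns. *)
Lemma row_supp_eq0 X (v : 'rV[K]_n) k : bruhat_minus X ->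
  (forall j : 'I_n, (k <= j)%N -> v 0 j = 0) ->
  (forall j : 'I_n, (n - k <= j)%N -> (v *m X) 0 j = 0) -> v = 0.
Proof.
move=> [b1 [b2 [t1 u1 t2 u2 EX]]] v0 vX0.
have s1 := row_trig_supp t1 v0.
have s2 := row_trig_supp (is_trig_invmx t2 u2) vX0.
suff e : v *m b1 *m rev_mx K n = 0.
  apply: (can_inj (mulmxK u1)); apply: (can_inj (mulmxK (unitmx_rev K n))).
  by rewrite e !mul0mx.
have e : v *m b1 *m rev_mx K n = v *m X *m invmx b2 by rewrite EX !mulmxA mulmxK.
apply/matrixP=> a j; rewrite ord1 [RHS]mxE.
case: (leqP (n - k) j) => kj; first by rewrite e s2.
by rewrite mul_mx_rev s1 //=; lia.
Qed.

(** A left kernel vector of the block, extended by zero, would contradict [row_supp_eq0]. *)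
Lemma bruhat_minus_solid X k : (k <= n)%N -> bruhat_minus X ->
  solid 0 (n - k) k X != 0.
Proof.
move=> kn BX; apply/det0P => -[xi xi0 xiX].
suff : xi *m rowsub (@shift_ord n' k 0) 1%:M = 0.
  move=> /matrixP z; case/negP: xi0; apply/eqP/matrixP=> a i.
  have := z a (shift_ord n' 0 i); rewrite !mxE (bigD1 i) //= !mxE eqxx mulr1.
  rewrite big1 ?addr0 // => j ji; rewrite !mxE.
  case: eqP => [e|]; last by rewrite mulr0.
  case/eqP: ji; apply: ord_inj; move: (congr1 val e).
  by rewrite /= !val_shift_ord.
apply: (row_supp_eq0 (k := k) BX) => j kj.
  rewrite mxE big1 // => i _; rewrite !mxE; case: eqP => [e|]; rewrite ?mulr0//.
  by move: kj; rewrite -e inordK; have := ltn_ord i; lia.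
have jk : (j - (n - k) < k)%N by have := ltn_ord j; lia.
move/matrixP: xiX => /(_ 0 (Ordinal jk)); rewrite [RHS]mxE => <-.
rewrite -mulmxA mul_rowsub_mx mul1mx !mxE; apply: eq_bigr => i _; rewrite !mxE.
congr (_ * X _ _); apply: ord_inj; rewrite inordK /=; have := ltn_ord j; lia.
Qed.

(** Elimination: a unipotent lower triangular $L$ is built such that $w_\circ LX$ is lower
    triangular, and then $X=L^{-1}w_\circ(w_\circ LX)$. *)
Lemma solid_bruhat_minus X : (forall k, (k <= n)%N -> solid 0 (n - k) k X != 0) ->
  bruhat_minus X.
Proof.
move=> sX.
have uX : X \in unitmx.
  by rewrite unitmxE unitfE -solid_full; have := sX n (leqnn n); rewrite subnn.
(* Row i of L: a combination of the first i+1 rows of X, with coefficient 1 on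
   row i, whose product with X vanishes in the last i columns. *)
have row_ex (i : 'I_n) : {v : 'rV[K]_n | [/\ forall j : 'I_n, (i < j)%N -> v 0 j = 0,
    v 0 i = 1 & forall j : 'I_n, (n - i <= j)%N -> (v *m X) 0 j = 0]}.
  pose S := mxsub (@shift_ord n' i 0) (@shift_ord n' i (n - i)) X.
  have uS : S \in unitmx by rewrite unitmxE unitfE; apply: sX; exact: ltnW.
  (* The combination of the rows above row $i$ that cancels row $i$ in the last $i$ columns; it
     exists because the block [S] is invertible. *)
  pose xi := - (colsub (@shift_ord n' i (n - i)) (row i X)) *m invmx S.
  have si := ltn_ord i.
  exists (xi *m rowsub (@shift_ord n' i 0) 1%:M + delta_mx 0 i); split.
  - move=> j ij; rewrite mxE [delta_mx _ _ _ _]mxE /= mxE big1 => [|a _].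
      by rewrite -val_eqE /= gtn_eqF // addr0.
    rewrite !mxE; case: eqP => [e|]; rewrite ?mulr0//.
    by move: ij; rewrite -e inordK; have := ltn_ord a; lia.
  - rewrite mxE [delta_mx _ _ _ _]mxE !eqxx /= mxE big1 ?add0r// => a _.
    rewrite !mxE; case: eqP => [e|]; rewrite ?mulr0//.
    by move/(congr1 val): e; rewrite /= val_shift_ord; have := ltn_ord a; lia.
  move=> j ij.
  have ja : (j - (n - i) < i)%N by have := ltn_ord j; lia.
  rewrite mulmxDl -rowE -mulmxA mul_rowsub_mx mul1mx mxE.
  have <- : shift_ord n' (n - i) (Ordinal ja) = j.
    by apply: ord_inj; rewrite inordK /=; have := ltn_ord j; lia.
  have -> : (xi *m rowsub (@shift_ord n' i 0) X) 0 (shift_ord n' (n - i) (Ordinal ja)) =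
      (xi *m S) 0 (Ordinal ja).
    by rewrite !mxE; apply: eq_bigr => b _; rewrite !mxE.
  by rewrite mulmxKV// !mxE addNr.
pose L : 'M[K]_n := \matrix_i sval (row_ex i).
have LE i j : L i j = sval (row_ex i) 0 j by rewrite mxE.
have tL : is_trig_mx L.
  by apply/is_trig_mxP=> i j ij; rewrite LE; have [h _ _] := svalP (row_ex i); exact: h.
have uL : L \in unitmx.
  rewrite unitmxE unitfE det_trig//; apply/prodf_neq0 => i _.
  by rewrite LE; have [_ -> _] := svalP (row_ex i); exact: oner_neq0.
exists (invmx L), (rev_mx K n *m L *m X); split.
- exact: is_trig_invmx.
- by rewrite unitmx_inv.
- apply/is_trig_mxP=> i j ij; rewrite -mulmxA mul_rev_mx.
  have -> : (L *m X) (rev_ord i) j = (sval (row_ex (rev_ord i)) *m X) 0 j.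
    by rewrite !mxE; apply: eq_bigr => k _; rewrite mxE.
  have [_ _ -> //=] := svalP (row_ex (rev_ord i)); have := ltn_ord i; lia.
- by rewrite !unitmx_mul unitmx_rev uL.
by rewrite !mulmxA -[_ *m rev_mx _ _ *m rev_mx _ _]mulmxA rev_mxK mulmx1 mulVmx// mul1mx.
Qed.

Lemma solid_diag_mx (t : 'rV[K]_n) p q m X :
  solid p q m (diag_mx t *m X) = \prod_(i < m) t 0 (shift_ord n' p i) * solid p q m X.
Proof.
rewrite /solid.
have -> : mxsub (@shift_ord n' m p) (@shift_ord n' m q) (diag_mx t *m X) =
    diag_mx (\row_i t 0 (shift_ord n' p i)) *m
      mxsub (@shift_ord n' m p) (@shift_ord n' m q) X.
  by apply/matrixP=> i j; rewrite !mul_diag_mx !mxE.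
by rewrite det_mulmx det_diag; congr (_ * _); apply: eq_bigr => i _; rewrite mxE.
Qed.

End OpenCell.

(** * Kernel and image of the Poisson tensor on the cell *)

Section CellLinearAlgebra.
Variables (K : numFieldType) (n' : nat).
Local Notation n := n'.+1.
Implicit Types (X A B : 'M[K]_n).

Lemma mxtrace_delta (B : 'M[K]_n) i j : \tr (delta_mx i j *m B) = B j i.
Proof.
rewrite /mxtrace (bigD1 i) //= [X in _ + X]big1 ?addr0 => [|k nk].
  rewrite mxE (bigD1 j) //= big1 ?addr0 => [|k nk]; first by rewrite mxE !eqxx mul1r.
  by rewrite mxE (negPf nk) andbF mul0r.
by rewrite mxE big1 // => l _; rewrite mxE (negPf nk) mul0r.
Qed.

Lemma mxtrace_nondegenerate (A : 'M[K]_n) :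
  (forall B, \tr (B *m A) = 0) -> A = 0.
Proof.
by move=> h; apply/matrixP=> i j; rewrite -(mxtrace_delta A j i) h mxE.
Qed.

Lemma hamvec_casimir k X : (k <= n)%N -> hamvec X (ham_cov n k X) = 0.
Proof.
move=> kn; apply/matrixP=> i j.
by rewrite -mxtrace_delta -pb_hamvec pb_casimir ?mxE.
Qed.

Lemma mxtrace_casimir_hamvec k X A : (k <= n)%N ->
  \tr (ham_cov n k X *m hamvec X A) = 0.
Proof. by move=> kn; rewrite -pb_hamvec pbC pb_hamvec hamvec_casimir// mulmx0 raddf0 oppr0. Qed.

(** The logarithmic derivative of $H(n,k+1)$ under scaling of row $i$ (0-based): the row belongs to
    the numerator if $i\le k$ and to the denominator otherwise. *)
Definition threshold i k : K := if (i <= k)%N then 1 else -1.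

(** Subtracting the equations for $k$ and $k+1$ leaves $2e_k=0$ for every $k$ but the last, and then
    any equation settles the last one. *)
Lemma threshold_system (e : 'I_n -> K) :
  (forall i : 'I_n, \sum_(k < n) e k * threshold i k = 0) -> forall k, e k = 0.
Proof.
move=> h.
have e0 (k : 'I_n) : (k < n')%N -> e k = 0.
  move=> kn; have k1 : (k.+1 < n)%N by [].
  have : \sum_(j < n) e j * threshold k j - \sum_(j < n) e j * threshold k.+1 j = 0.
    by rewrite (h k) (h (Ordinal k1)) subrr.
  rewrite -sumrB (bigD1 k) //= big1 ?addr0 => [|j jk].
    rewrite /threshold leqnn ltnn -mulrBr opprK -mulr2n mulr_natr => /eqP.
    by rewrite mulrn_eq0 => /eqP.
  rewrite /threshold; have : (j != k :> nat) by [].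
  by case: (ltngtP k j) => // _ _; rewrite subrr.
move=> k; case: (ltnP k n') => [/e0//|nk].
have := h k; rewrite (bigD1 k) //= big1 ?addr0 => [|j jk].
  by rewrite /threshold leqnn mulr1.
rewrite e0 ?mul0r//; have : (j != k :> nat) by [].
by have := ltn_ord j; have := ltn_ord k; lia.
Qed.

Lemma unitmx_threshold (c : 'I_n -> K) : (forall k, c k != 0) ->
  \matrix_(k, i) (c k * threshold i k) \in (@unitmx K n).
Proof.
move=> c0; rewrite unitmxE unitfE; apply/det0P => -[v v0 /matrixP vT].
case/negP: v0; apply/eqP/matrixP=> a k; rewrite ord1 mxE.
have /(_ k)/eqP : forall k, v 0 k * c k = 0.
  apply: threshold_system => i; have := vT 0 i; rewrite [RHS]mxE => E; rewrite -[RHS]E [RHS]mxE.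
  by apply: eq_bigr => j _; rewrite mxE mulrA.
by rewrite mulf_eq0 (negPf (c0 k)) orbF => /eqP.
Qed.

Definition ham_val l k X : K := ham_num l k X / ham_den l k X.

Lemma entryZB (d a b : K) (P Q : 'M[K]_n) i j :
  (d *: (a *: P - b *: Q)) i j = d * (a * P i j - b * Q i j).
Proof. by rewrite !mxE. Qed.

Section AtPoint.
Variables (X : 'M[K]_n).
Hypotheses (BX : bruhat_minus X) (BXT : bruhat_minus X^T).

Lemma ham_num_neq0 k : (k <= n)%N -> ham_num n k X != 0.
Proof. by move=> kn; apply: bruhat_minus_solid. Qed.

Lemma ham_den_neq0 k : (k <= n)%N -> ham_den n k X != 0.
Proof.
move=> kn; rewrite /ham_den -solid_tr.
by have := bruhat_minus_solid (leq_subr k n) BXT; rewrite subKn.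
Qed.

Lemma ham_val_neq0 k : (k <= n)%N -> ham_val n k X != 0.
Proof. by move=> kn; rewrite mulf_neq0 ?invr_eq0 ?ham_num_neq0 ?ham_den_neq0. Qed.

Lemma casimir_row (k i : 'I_n) :
  (X *m ham_cov n k.+1 X) i i = ham_val n k.+1 X * threshold i k.
Proof.
have kn := ltn_ord k; have D0 := ham_den_neq0 kn.
rewrite /ham_cov -scalemxAr mulmxBr -!scalemxAr entryZB.
have [r0 r1 _ _] := @minor_like_solid K n' 0 (n - k.+1) k.+1 X ltac:(lia) ltac:(lia).
have [s0 s1 _ _] := @minor_like_solid K n' k.+1 0 (n - k.+1) X ltac:(lia) ltac:(lia).
rewrite /threshold; case: leqP => ik.
  rewrite r1 ?s0 /itv; try lia; rewrite eqxx mulr1n mulr0 subr0 -/(ham_num _ _ _).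
  by rewrite /ham_val mulr1; field.
rewrite r0 ?s1 /itv; try (have := ltn_ord i; lia).
rewrite eqxx mulr1n mulr0 sub0r -/(ham_den _ _ _).
by rewrite /ham_val; field.
Qed.

Lemma casimir_col (k j : 'I_n) :
  (ham_cov n k.+1 X *m X) j j = ham_val n k.+1 X * threshold (rev_ord j) k.
Proof.
have kn := ltn_ord k; have D0 := ham_den_neq0 kn.
rewrite /ham_cov -scalemxAl mulmxBl -!scalemxAl entryZB.
have [_ _ r0 r1] := @minor_like_solid K n' 0 (n - k.+1) k.+1 X ltac:(lia) ltac:(lia).
have [_ _ s0 s1] := @minor_like_solid K n' k.+1 0 (n - k.+1) X ltac:(lia) ltac:(lia).
have jn := ltn_ord j.
rewrite /threshold /=; case: leqP => ik.
  rewrite r1 ?s0 /itv; try lia; rewrite eqxx mulr1n mulr0 subr0 -/(ham_num _ _ _).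
  by rewrite /ham_val mulr1; field.
rewrite r0 ?s1 /itv; try lia.
rewrite eqxx mulr1n mulr0 sub0r -/(ham_den _ _ _).
by rewrite /ham_val; field.
Qed.

(** Since the threshold matrix is invertible, some combination of the Casimir covectors has the same
    diagonal after multiplication by $X$ as $A$ has; the difference vanishes by [hamvec_ker]. *)
Lemma hamvec_ker_casimir A : hamvec X A = 0 ->
  exists e : 'I_n -> K, A = \sum_(k < n) e k *: ham_cov n k.+1 X.
Proof.
move=> A0; pose T : 'M[K]_n := \matrix_(k, i) (ham_val n k.+1 X * threshold i k).
have uT : T \in unitmx by apply: unitmx_threshold => k; apply: ham_val_neq0.
pose d : 'rV[K]_n := \row_j (A *m X) (rev_ord j) (rev_ord j).
exists (fun k => (d *m invmx T) 0 k).
apply/eqP; rewrite -subr_eq0; apply/eqP; apply: (hamvec_ker BX BXT).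
  rewrite raddfB /= A0 sub0r raddf_sum /= big1 ?oppr0// => k _.
  by rewrite linearZ /= hamvec_casimir ?scaler0.
move=> j; rewrite mulmxBl mxE [X in _ + X]mxE mulmx_suml summxE.
under eq_bigr do rewrite -scalemxAl mxE casimir_col.
have : d = (d *m invmx T) *m T by rewrite mulmxKV.
move=> /matrixP/(_ 0 (rev_ord j)); rewrite mxE rev_ordK => ->.
rewrite mxE; apply/eqP; rewrite subr_eq0; apply/eqP; apply: eq_bigr => k _.
by rewrite [T _ _]mxE.
Qed.

Definition casimir_differentials (v : 'M[K]_n) : 'rV[K]_n :=
  \row_k \tr (ham_cov n k.+1 X *m v).

Fact casimir_differentials_is_linear : linear casimir_differentials.
Proof.
by move=> a A B; apply/matrixP=> b i; rewrite mxE linearP linearP /= !mxE.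
Qed.
HB.instance Definition _ := GRing.isLinear.Build K 'M[K]_n 'rV[K]_n *:%R
  casimir_differentials casimir_differentials_is_linear.

(** The image lies in the kernel of the Casimir differentials, and two bounds force equality. The
    kernel of [hamvec X] meets the common kernel of the $n$ forms $A\mapsto(AX)_{ii}$ in 0, so the
    rank is at least $n^2-n$; the $n$ Casimir differentials are jointly surjective, so their kernel
    has dimension at most $n^2-n$. *)
Lemma limg_hamvec :
  limg (linfun (hamvec X)) = lker (linfun casimir_differentials) /\
  (\dim (limg (linfun (hamvec X))) = n * n - n)%N.
Proof.
set f := linfun (hamvec X); set h := linfun casimir_differentials.
pose g0 A : 'rV[K]_n := \row_i (A *m X) i i.
have lin_g : linear g0.
  by move=> a A B; apply/matrixP=> b i; rewrite !mxE mulr_sumr -big_split /=;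
    apply: eq_bigr => k _; rewrite !mxE mulrDl mulrA.
pose gL : {linear 'M[K]_n -> 'rV[K]_n} :=
  HB.pack g0 (GRing.isLinear.Build _ _ _ _ _ lin_g).
pose g : 'Hom('M[K]_n, 'rV[K]_n) := linfun gL.
have lf : (n * n - n <= \dim (limg f))%N.
  have kg : (lker f :&: lker g = 0)%VS.
    apply/eqP; rewrite -subv0; apply/subvP => A; rewrite memv_cap !memv_ker !lfunE /=.
    move=> /andP[/eqP A0 /eqP gA]; rewrite memv0; apply/eqP.
    apply: (hamvec_ker BX BXT A0) => i.
    by have /matrixP/(_ 0 i) := gA; rewrite !mxE.
  have := limg_ker_dim f fullv; rewrite capfv dimvf /dim /= => <-.
  have := limg_ker_dim g (lker f); rewrite kg dimv0 add0n => <-.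
  rewrite leq_subLR leq_add2r.
  by rewrite (leq_trans (dimvS (subvf _)))// dimvf /dim /= mul1n.
have fh : (limg f <= lker h)%VS.
  apply/subvP => _ /memv_imgP[A _ ->]; rewrite memv_ker !lfunE /=; apply/eqP/matrixP=> a k.
  by rewrite !mxE mxtrace_casimir_hamvec.
have hf : limg h = fullv.
  apply/eqP; rewrite eqEsubv subvf; apply/subvP => y _.
  pose T : 'M[K]_n := \matrix_(k, i) (ham_val n k.+1 X * threshold i k).
  have uT : T \in unitmx by apply: unitmx_threshold => k; apply: ham_val_neq0.
  pose t : 'rV[K]_n := y *m invmx T^T.
  have uTT : T^T \in unitmx by rewrite unitmx_tr.
  (* The tangent vector scaling row $i$ by $t_i$; by [casimir_row] the Casimir differentials act on
     it through the matrix [T]. *)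
  have -> : y = h (diag_mx t *m X); last by apply: memv_img; exact: memvf.
  rewrite lfunE /= -[LHS](mulmxKV uTT); apply/matrixP=> a k; rewrite ord1 !mxE.
  rewrite mulmxA mxtrace_mulC mulmxA /mxtrace; apply: eq_bigr => i _.
  rewrite mul_mx_diag [RHS]mxE casimir_row -/t mulrC; congr (_ * _).
  by rewrite !mxE.
have dk : (\dim (lker h) <= n * n - n)%N.
  have := limg_ker_dim h fullv; rewrite capfv hf !dimvf /dim /= mul1n => <-.
  by rewrite addnK.
have fhE : limg f = lker h by apply/eqP; rewrite eqEdim fh (leq_trans dk).
by split=> //; apply/eqP; rewrite eqn_leq lf fhE dk.
Qed.

Lemma characteristic_casimir (v : 'M[K]_n) :
  (forall k, (1 <= k <= n)%N -> \tr (ham_cov n k X *m v) = 0) ->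
  exists A, v = hamvec X A.
Proof.
move=> v0; have : v \in limg (linfun (hamvec X)).
  rewrite limg_hamvec.1 memv_ker lfunE /=; apply/eqP/matrixP=> a k; rewrite !mxE v0 //=.
by move=> /memv_imgP[A _ ->]; exists A; rewrite lfunE.
Qed.

End AtPoint.

(* With A = delta_mx j i for i >= k and j >= l, the hypothesis reads
   (xi X)_j (X eta)_i = 0. *)
Lemma hamvec_bilinear_neq0 X k l (xi : 'rV[K]_n) (eta : 'cV[K]_n) :
  bruhat_minus X -> (k <= l <= n)%N ->
  (forall i : 'I_n, (k <= i)%N -> xi 0 i = 0) -> xi != 0 ->
  (forall j : 'I_n, ~~ (l - k <= j < l)%N -> eta j 0 = 0) -> eta != 0 ->
  (forall j : 'I_n, (l - k <= j < l)%N -> (xi *m X) 0 j = 0) ->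
  (forall i : 'I_n, (i < k)%N -> (X *m eta) i 0 = 0) ->
  (forall A, xi *m hamvec X A *m eta = 0) -> False.
Proof.
move=> BX /andP[kl ln] xi_s xi0 eta_s eta0 xiX Xeta H.
have key (i j : 'I_n) : (k <= i)%N -> (l <= j)%N -> (xi *m X) 0 j * (X *m eta) i 0 = 0.
  move=> ki lj.
  have /matrixP/(_ 0 0) := H (delta_mx j i).
  (* All signs here are $-1$ because [xi] is supported strictly before $i$; in [E2] they are all
     $+1$ because [eta] is supported strictly before $j$. The two terms of [hamvec] therefore add up
     instead of cancelling. *)
  have E1 : xi *m sg (X *m delta_mx j i) = - (xi *m X) 0 j *: delta_mx 0 i.
    apply/matrixP=> a b; rewrite ord1 [RHS]mxE [delta_mx _ _ _ _]mxE eqxx /=.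
    rewrite [(xi *m X) 0 j]mxE -sumrN mulr_suml mxE.
    apply: eq_bigr => c _; rewrite [sg _ _ _]mxE mxE (bigD1 j) //= big1 => [|d dj].
      rewrite addr0 mxE eqxx /= /nsign; case: eqP => [->|]; last by rewrite !mulr0.
      case: (ltnP c k) => [ck|/xi_s->]; last by ring.
      have -> : (i < c)%N = false by lia.
      have -> : (c < i)%N by lia.
      by rewrite /=; ring.
    by rewrite mxE (negPf dj) mulr0.
  have E2 : sg (delta_mx j i *m X) *m eta = (X *m eta) i 0 *: delta_mx j 0.
    apply/matrixP=> a b; rewrite ord1 [RHS]mxE [delta_mx _ _ _ _]mxE eqxx andbT.
    rewrite [(X *m eta) i 0]mxE mulr_suml mxE.
    apply: eq_bigr => c _; rewrite [sg _ _ _]mxE mxE (bigD1 i) //= big1 => [|d dj].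
      rewrite addr0 mxE eqxx andbT /nsign.
      case: eqP => [->|]; last by rewrite !(mul0r, mulr0).
      case: (boolP (l - k <= c < l)%N) => [/andP[_ cl]|/eta_s->]; last by ring.
      have -> : (j < c)%N = false by lia.
      have -> : (c < j)%N by lia.
      by rewrite /=; ring.
    by rewrite mxE (negPf dj) andbF mul0r.
  rewrite /hamvec mulmxBr mulmxBl !mulmxA E1 -!mulmxA E2 -scalemxAl -!scalemxAr.
  rewrite [xi *m (X *m _)]mulmxA -rowE -colE [RHS]mxE => h.
  have : ((xi *m X) 0 j * (X *m eta) i 0) *+ 2 = 0.
    have e2 (u v : K) (P Q : 'M[K]_1) : (u *: P - v *: Q) 0 0 = u * P 0 0 - v * Q 0 0.
      by rewrite !mxE.
    by move: h; rewrite e2 [row _ _ _ _]mxE [col _ _ _ _]mxE => h; rewrite -[RHS]oppr0 -h; ring.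
  by move/eqP; rewrite mulrn_eq0 => /eqP.
(* By invertibility $X\eta\ne0$, and its first $k$ entries vanish, so such an $i$ remains. Then
   [key] makes $\xi X$ vanish from column $l$ on, and with [xiX] in the last $k$ columns. *)
have [i ki Xi0] : exists2 i : 'I_n, (k <= i)%N & (X *m eta) i 0 != 0.
  case: (pickP (fun i : 'I_n => (k <= i)%N && ((X *m eta) i 0 != 0))) => [i|h].
    by move=> /andP[]; exists i.
  case/eqP: eta0; apply: (can_inj (mulKmx (bruhat_minus_unit BX))).
  rewrite mulmx0; apply/matrixP=> i a; rewrite ord1 [RHS]mxE.
  case: (ltnP i k) => [/Xeta//|ki]; have := h i.
  by rewrite ki /= => /negbFE/eqP.
case/eqP: xi0; apply: (row_supp_eq0 (k := k) BX xi_s) => j nj.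
case: (ltnP j l) => jl; first by rewrite xiX// jl andbT; lia.
by have /eqP := key i j ki jl; rewrite mulf_eq0 (negPf Xi0) orbF => /eqP.
Qed.

Lemma solid_cov_supp p q m X (a b : 'I_n) : (p + m <= n)%N -> (q + m <= n)%N ->
  solid_cov p q m X b a != 0 -> (p <= a < p + m)%N && (q <= b < q + m)%N.
Proof.
move=> pm qm; apply: contraR; rewrite negb_and => h; apply/eqP.
rewrite /solid_cov /sub_cov; case/orP: h => h.
  rewrite mxE big1 // => i _; rewrite !mxE; case: eqP => [e|]; rewrite ?mulr0//.
  by case/negP: h; rewrite -e val_shift_ord//; have := ltn_ord i; lia.
rewrite -mulmxA mxE big1 // => i _; rewrite !mxE; case: eqP => [e|]; rewrite ?mul0r//.
by case/negP: h; rewrite e val_shift_ord//; have := ltn_ord i; lia.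
Qed.

(** The cofactor of the bottom right corner is again a solid minor, with the same top left corner,
    hence nonzero where all initial minors are. *)
Lemma solid_cov_corner p q m X (a b : 'I_n) : (p + m <= n)%N -> (q + m <= n)%N ->
  (0 < m)%N -> a.+1 = (p + m)%N -> b.+1 = (q + m)%N ->
  solid_cov p q m X b a = solid p q m.-1 X.
Proof.
case: m => // m pm qm _ {}/eqP ea {}/eqP eb.
rewrite addnS eqSS in ea; rewrite addnS eqSS in eb; move: ea eb => /eqP ea /eqP eb.
have so_inj r (c : 'I_n) i : (r + m.+1 <= n)%N -> c = (r + m)%N :> nat ->
    (c == @shift_ord n' m.+1 r i) = (i == ord_max).
  move=> rm ec; rewrite -!val_eqE /= val_shift_ord// ec.
  by have := ltn_ord i; lia.
rewrite /solid_cov /sub_cov mxE (bigD1 ord_max) //= big1 ?addr0 => [|i im].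
  rewrite [X in _ * X]mxE [X in _ * X]mxE eq_sym so_inj// eqxx mulr1.
  rewrite mxE (bigD1 ord_max) //= big1 ?addr0 => [|i im].
    rewrite !mxE so_inj// eqxx mul1r /cofactor /= addnn -signr_odd odd_double mul1r.
    congr (\det _); apply/matrixP=> i j; rewrite !mxE; congr (X _ _); apply: ord_inj.
      by rewrite !val_shift_ord ?lift_max//; lia.
    by rewrite !val_shift_ord ?lift_max//; lia.
  by rewrite !mxE so_inj// (negPf im) mul0r.
by rewrite [X in _ * X]mxE [X in _ * X]mxE eq_sym so_inj// (negPf im) mulr0.
Qed.

(* The minors of the two shapes below are determined by the position of their
   bottom right corner, and their differentials are triangular with respect to
   these positions. *)
Lemma ham_cov_independent X (s : seq (nat * nat)) (c : nat * nat -> K) :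
  (forall p m, (p + m <= n)%N -> solid 0 p m X != 0 /\ solid p 0 m X != 0) ->
  uniq s -> (forall p : nat * nat, p \in s -> (1 <= p.2 <= p.1)%N && (p.1 <= n)%N) ->
  \sum_(p <- s) c p *: ham_cov p.1 p.2 X = 0 -> forall p : nat * nat, p \in s -> c p = 0.
Proof.
move=> solid0 us hs sum0.
have entry0 (a b : 'I_n) : \sum_(p <- s) c p * ham_cov p.1 p.2 X b a = 0.
  have /matrixP/(_ b a) := sum0; rewrite summxE [RHS]mxE => E; rewrite -[RHS]E.
  by apply: eq_bigr => p _; rewrite [RHS]mxE.
(* Descending induction on $t$, over the Hamiltonians with a corner whose coordinate sum is at least
   $t$. In 1-based coordinates the corners of [ham_num l k] and [ham_den l k] are $(k,l)$ and
   $(l,l-k)$, with sums $l+k$ and $2l-k$; the second exists only for $k<l$. *)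
suff S t (p : nat * nat) : p \in s ->
    (t <= p.1 + p.2 \/ (p.2 < p.1 /\ t + p.2 <= p.1.*2))%N -> c p = 0.
  by move=> p ps; apply: (S 0%N) => //; left.
have [N] := ubnP (n.*2.+1 - t)%N; elim: N t p => // N IH t p tN ps tp.
have [t0|t0] := leqP n.*2.+1 t.
  by have := hs p ps; case: tp; lia.
have {}IH (q : nat * nat) : q \in s ->
    (t < q.1 + q.2 \/ (q.2 < q.1 /\ t + q.2 < q.1.*2))%N -> c q = 0.
  by move=> qs h; apply: (IH t.+1) => //; lia.
have [k0 kl] : (0 < p.2)%N /\ (p.2 <= p.1 <= n)%N by have := hs p ps; lia.
have single (a b : 'I_n) : ham_cov p.1 p.2 X b a != 0 ->
    (forall q : nat * nat, q \in s -> q != p -> c q = 0 \/ ham_cov q.1 q.2 X b a = 0) -> c p = 0.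
  move=> n0 h; have := entry0 a b; rewrite (bigD1_seq p)//= big1_seq ?addr0.
    by move/eqP; rewrite mulf_eq0 (negPf n0) orbF => /eqP.
  by move=> q /andP[qp qs]; case: (h q qs qp) => ->; rewrite ?mulr0 ?mul0r.
have ham0 (q : nat * nat) (a b : 'I_n) : q \in s ->
    solid_cov 0 (q.1 - q.2) q.2 X b a = 0 ->
    solid_cov q.2 0 (q.1 - q.2) X b a = 0 -> ham_cov q.1 q.2 X b a = 0.
  by move=> qs h1 h2; rewrite /ham_cov entryZB h1 h2 !mulr0 subr0 mulr0.
have supp1 (q : nat * nat) (a b : 'I_n) : q \in s -> solid_cov 0 (q.1 - q.2) q.2 X b a != 0 ->
    (a < q.2)%N && (b < q.1)%N.
  by move=> qs /solid_cov_supp h; have hq := hs q qs; move: (h ltac:(lia) ltac:(lia)); lia.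
have supp2 (q : nat * nat) (a b : 'I_n) : q \in s -> solid_cov q.2 0 (q.1 - q.2) X b a != 0 ->
    [&& (q.2 <= a)%N, (a < q.1)%N & (b < q.1 - q.2)%N].
  by move=> qs /solid_cov_supp h; have hq := hs q qs; move: (h ltac:(lia) ltac:(lia)); lia.
have sum_le (q : nat * nat) : q \in s -> c q != 0 ->
    (q.1 + q.2 <= t)%N && ((q.2 < q.1) ==> (q.1.*2 <= t + q.2))%N.
  move=> qs; apply: contraR => h; apply/eqP; apply: IH => //.
  by move: h; case: (ltnP q.2 q.1) => /=; lia.
have pair_eq (q : nat * nat) : q != p -> q.1 = p.1 -> q.2 = p.2 -> False.
  by move=> /eqP h e1 e2; apply: h; rewrite (surjective_pairing q) e1 e2 -surjective_pairing.
have D0 : ham_den p.1 p.2 X != 0.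
  by have [_] := solid0 p.2 (p.1 - p.2)%N ltac:(lia).
have N0 : ham_num p.1 p.2 X != 0.
  by have [] := solid0 (p.1 - p.2)%N p.2 ltac:(lia).
have ham_entry b a : ham_cov p.1 p.2 X b a = ham_den p.1 p.2 X ^- 2 *
    (ham_den p.1 p.2 X * solid_cov 0 (p.1 - p.2) p.2 X b a -
     ham_num p.1 p.2 X * solid_cov p.2 0 (p.1 - p.2) X b a).
  by rewrite /ham_cov entryZB.
have DV0 : ham_den p.1 p.2 X ^- 2 != 0 by rewrite invr_eq0 expf_neq0.
have [cp0|] := eqVneq (c p) 0; first by [].
move=> cp; have tle := sum_le p ps cp.
(* The entry at the corner with sum $t$ isolates [c p]. A differential is supported weakly above and
   left of its corner, so another Hamiltonian with nonzero coefficient meets this entry only if it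
   has a corner there. Numerator corners satisfy $k\le l$ while denominator corners lie below the
   diagonal, so the corner determines the pair. *)
case: tp => [t1|[pp t2]].
  have an : (p.2.-1 < n)%N by lia.
  have bn : (p.1.-1 < n)%N by lia.
  apply: (single (Ordinal an) (Ordinal bn)).
    rewrite ham_entry; have -> : solid_cov p.2 0 (p.1 - p.2) X (Ordinal bn) (Ordinal an) = 0.
      by apply/eqP/contraT => /(supp2 p _ _ ps) /=; lia.
    rewrite mulr0 subr0 !mulf_neq0//.
    rewrite solid_cov_corner /=; try lia.
    by have [] := solid0 (p.1 - p.2)%N p.2.-1 ltac:(lia).
  move=> q qs qp; case: (eqVneq (c q) 0) => [|cq]; [by left|right].
  have := sum_le q qs cq; have hq := hs q qs => qt.
  apply: (ham0 _ _ _ qs); [apply/eqP/contraT => /(supp1 q _ _ qs) /= h|apply/eqP/contraT => /(supp2 q _ _ qs) /= h].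
    by exfalso; apply: (pair_eq q qp); clear - h qt t1; lia.
  by case/andP: hq => /andP[h1 _] _; case/andP: qt => _ qt; exfalso; clear - h qt t1 kl k0 h1; lia.
have an : (p.1.-1 < n)%N by lia.
have bn : ((p.1 - p.2).-1 < n)%N by lia.
apply: (single (Ordinal an) (Ordinal bn)).
  rewrite ham_entry; have -> : solid_cov 0 (p.1 - p.2) p.2 X (Ordinal bn) (Ordinal an) = 0.
    by apply/eqP/contraT => /(supp1 p _ _ ps) /=; lia.
  rewrite mulr0 sub0r mulf_neq0// oppr_eq0 mulf_neq0//.
  rewrite solid_cov_corner /=; try lia.
  by have [] := solid0 p.2 (p.1 - p.2).-1 ltac:(lia).
move=> q qs qp; case: (eqVneq (c q) 0) => [|cq]; [by left|right].
have := sum_le q qs cq; have hq := hs q qs => qt.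
apply: (ham0 _ _ _ qs); [apply/eqP/contraT => /(supp1 q _ _ qs) /= h|apply/eqP/contraT => /(supp2 q _ _ qs) /= h].
  by exfalso; clear - h qt hq t2 k0 pp; lia.
by exfalso; apply: (pair_eq q qp); case/andP: qt => _ qt; clear - h qt t2 pp; lia.
Qed.

End CellLinearAlgebra.

(** * The Hamiltonians as functions on matrices *)

Section MinorsOfIntervals.
Variables (K : comUnitRingType) (n' : nat).
Local Notation n := n'.+1.

Lemma enum_index_itv p m : (p + m <= n)%N ->
  enum (index_itv n p.+1 (p + m)) = [seq inord i | i <- iota p m].
Proof.
move=> pm; apply: (inj_map (@ord_inj n)).
rewrite -map_comp.
have -> : [seq (@nat_of_ord n \o inord) i | i <- iota p m] = iota p m.
  rewrite -[RHS]map_id; apply/eq_in_map => i; rewrite mem_iota => /andP[_ h] /=.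
  by rewrite inordK// (leq_trans h).
rewrite /index_itv {1}/enum_mem -enumT.
have -> : [seq x <- enum 'I_n | mem [set i : 'I_n | (p.+1 <= i.+1 <= p + m)%N]%SET x] =
          [seq x <- enum 'I_n | (fun i : nat => (p <= i < p + m)%N) (nat_of_ord x)].
  by apply: eq_filter => i; rewrite /= inE ltnS.
rewrite -(filter_map (@nat_of_ord n) (fun i : nat => (p <= i < p + m)%N)) val_enum_ord.
have {1}-> : n = (p + (m + (n - (p + m))))%N by lia.
rewrite !iotaD !filter_cat add0n.
rewrite (eq_in_filter (a2 := pred0)) => [|i]; last by rewrite mem_iota /=; lia.
rewrite [X in _ ++ _ ++ X](eq_in_filter (a2 := pred0)) => [|i]; last first.
  by rewrite mem_iota /=; lia.
rewrite !filter_pred0 cats0 /= (eq_in_filter (a2 := predT)) ?filter_predT// => i.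
by rewrite mem_iota.
Qed.

Lemma minor_solid p q m (X : 'M[K]_n) : (p + m <= n)%N -> (q + m <= n)%N ->
  minor (index_itv n p.+1 (p + m)) (index_itv n q.+1 (q + m)) X = solid p q m X.
Proof.
move=> pm qm; rewrite /minor /solid.
have cI : #|index_itv n p.+1 (p + m)| = m.
  by rewrite cardE enum_index_itv// size_map size_iota.
(* Entries are indexed by natural numbers so that the size of the determinant can be rewritten to
   [m] without casts. *)
pose G (i j : nat) := X (inord (p + i)) (inord (q + j)).
transitivity (\det (\matrix_(i < #|index_itv n p.+1 (p + m)|,
     j < #|index_itv n p.+1 (p + m)|) G i j)).
  congr (\det _); apply/matrixP=> i j; rewrite !mxE /G.
  have im : (i < m)%N by have := ltn_ord i; rewrite [X in (_ < X)%N -> _]cI.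
  have jm : (j < m)%N by have := ltn_ord j; rewrite [X in (_ < X)%N -> _]cI.
  rewrite /enum_val !enum_index_itv// !(nth_map 0%N) ?size_iota//.
  by rewrite !nth_iota.
by rewrite cI.
Qed.

Lemma Delta_ham_num l k (X : 'M[K]_n) : (1 <= k <= l)%N -> (l <= n)%N ->
  Delta l k X = ham_num l k X.
Proof.
move=> kl ln; rewrite /Delta /ham_num -minor_solid; try lia.
by rewrite add0n subnK ?addn1//; case/andP: kl.
Qed.

Lemma Delta'_ham_den l k (X : 'M[K]_n) : (k < l <= n)%N ->
  Delta' l (l - k) X = ham_den l k X.
Proof.
move=> kl; rewrite /Delta' /ham_den -minor_solid; try lia.
have -> : (l - (l - k) + 1 = k.+1)%N by lia.
by have -> : (k + (l - k) = l)%N by lia.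
Qed.

Lemma lead_minor_ham_num l (X : 'M[K]_n) : (l <= n)%N ->
  lead_minor l X = ham_num l l X.
Proof. by move=> ln; rewrite /lead_minor /ham_num subnn -minor_solid. Qed.

End MinorsOfIntervals.

Lemma ham_ham_val (K : numFieldType) n' l k (X : 'M[K]_n'.+1) :
  (1 <= k <= l)%N -> (l <= n'.+1)%N -> ham (l, k) X = ham_val l k X.
Proof.
move=> kl ln; rewrite /ham /ham_val; case: ltnP => [kl'|lk].
  by rewrite Delta_ham_num// Delta'_ham_den ?kl'.
have -> : k = l by lia.
by rewrite lead_minor_ham_num// /ham_den subnn solid0 divr1.
Qed.

Lemma ham_dom_den (K : numFieldType) n' l k (X : 'M[K]_n'.+1) :
  (1 <= k <= l)%N -> (l <= n'.+1)%N ->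
  ham_dom (l, k) X <-> ham_den l k X != 0.
Proof.
move=> kl ln; rewrite /ham_dom /=; split=> [h|h kl'].
  case: (ltnP k l) => [kl'|lk]; first by rewrite -Delta'_ham_den ?kl'// h.
  have -> : k = l by lia.
  by rewrite /ham_den subnn solid0 oner_neq0.
by rewrite Delta'_ham_den ?kl'.
Qed.

Lemma perm_mx_w0 (K : numFieldType) n : perm_mx (w0 n) = rev_mx K n.
Proof.
apply/matrixP=> i j; rewrite !mxE /w0 permE.
by congr (_%:R); rewrite -[in LHS](can_eq rev_ordK) rev_ordK.
Qed.

Lemma double_coset_minus (K : numFieldType) n (X : 'M[K]_n) :
  double_coset (@borel_minus K n) X <-> bruhat_minus X.
Proof.
rewrite /double_coset /= perm_mx_w0; split.
  by move=> [b1 [b2 [[? ?] [? ?] ?]]]; exists b1, b2.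
by move=> [b1 [b2 [? ? ? ? ?]]]; exists b1, b2.
Qed.

Lemma double_coset_plus (K : numFieldType) n (X : 'M[K]_n) :
  double_coset (@borel_plus K n) X <-> bruhat_minus X^T.
Proof.
rewrite /double_coset /= perm_mx_w0; split.
  move=> [b1 [b2 [[? ?] [? ?] ->]]]; exists b2^T, b1^T; split=> //; rewrite ?unitmx_tr//.
  by rewrite !trmx_mul tr_rev_mx mulmxA.
move=> [b1 [b2 [? ? ? ? e]]]; exists b2^T, b1^T; split; rewrite /borel_plus /= ?trmxK ?unitmx_tr//.
by apply: trmx_inj; rewrite e !trmx_mul tr_rev_mx !trmxK mulmxA.
Qed.

Lemma open_double_bruhat_cellE (K : numFieldType) n (X : 'M[K]_n) :
  open_double_bruhat_cell X <-> bruhat_minus X /\ bruhat_minus X^T.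
Proof.
rewrite /open_double_bruhat_cell /setI /=.
by rewrite double_coset_minus double_coset_plus; split=> -[].
Qed.

(** * Differentials of determinants and Hamiltonians *)

Section Differentials.
Variable (K : numFieldType).

Lemma differentiable_bigsum (V W : normedModType K) (I : Type) (s : seq I)
    (F : I -> V -> W) x :
  (forall i, differentiable (F i) x) -> differentiable (fun y => \sum_(i <- s) F i y) x.
Proof.
move=> dF; elim: s => [|i s IH].
  under eq_fun do rewrite big_nil; exact: differentiable_cst.
under eq_fun do rewrite big_cons; exact: differentiableD.
Qed.

Lemma differentiable_bigprod (V : normedModType K) (I : Type) (s : seq I)
    (F : I -> V -> K) x :
  (forall i, differentiable (F i) x) -> differentiable (fun y => \prod_(i <- s) F i y) x.
Proof.
move=> dF; elim: s => [|i s IH].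
  under eq_fun do rewrite big_nil; exact: differentiable_cst.
under eq_fun do rewrite big_cons; exact: differentiableM.
Qed.

Lemma differentiable_det m (Y : 'M[K]_m) : differentiable (fun Z : 'M[K]_m => \det Z) Y.
Proof.
apply: differentiable_bigsum => s; apply: differentiableM; first exact: differentiable_cst.
by apply: differentiable_bigprod => i; exact: differentiable_coord.
Qed.

Lemma diff_sum_delta m n (W : normedModType K) (f : 'M[K]_(m, n) -> W) X v :
  'd f X v = \sum_i \sum_j v i j *: 'd f X (delta_mx i j).
Proof.
rewrite {1}(matrix_sum_delta v) linear_sum; apply: eq_bigr => i _.
by rewrite linear_sum; apply: eq_bigr => j _; rewrite linearZ.
Qed.

(** Expansion along row $i$ shows that the determinant is affine in the entry $(i,j)$, so the
    difference quotient is constant. *)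
Lemma derive_det m (Y : 'M[K]_m) i j :
  'D_(delta_mx i j) (fun Z : 'M[K]_m => \det Z) Y = cofactor Y i j.
Proof.
rewrite /derive; apply: cvg_lim => //.
apply: (@cvg_trans _ (cofactor Y i j @[h --> (0 : K)^'])); last exact: cvg_cst.
apply: near_eq_cvg; near=> h.
have h0 : h != 0 by near: h; exact: nbhs_dnbhs_neq.
rewrite /= (expand_det_row Y i) (expand_det_row _ i) -sumrB.
have cof k : cofactor (h *: delta_mx i j + Y) i k = cofactor Y i k.
  congr (_ * \det _); apply/matrixP=> a b; rewrite !mxE.
  by rewrite eq_sym (negPf (neq_lift _ _)) mulr0 add0r.
under eq_bigr do rewrite cof -mulrBl 2!mxE addrK mxE eqxx /=.
rewrite (bigD1 j) //= big1 => [|k /negPf nk]; last by rewrite nk mulr0 mul0r.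
by rewrite eqxx mulr1 addr0 -[RHS]/(_ * _) mulKf.
Unshelve. all: by end_near. Qed.

Lemma diff_det m (Y W : 'M[K]_m) :
  'd (fun Z : 'M[K]_m => \det Z) Y W = \tr (\adj Y *m W).
Proof.
rewrite diff_sum_delta /mxtrace; under [RHS]eq_bigr do rewrite mxE.
rewrite [RHS]exchange_big /=; apply: eq_bigr => i _; apply: eq_bigr => j _.
by rewrite -deriveE ?derive_det; [rewrite mxE mulrC|exact: differentiable_det].
Qed.

Lemma differentiable_mx (V : normedModType K) m n (f : V -> 'M[K]_(m, n)) x :
  (forall i j, differentiable (fun y => f y i j) x) -> differentiable f x.
Proof.
move=> df.
have -> : f = fun y => \sum_i \sum_j f y i j *: delta_mx i j.
  by apply/funext => y; rewrite -matrix_sum_delta.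
apply: differentiable_bigsum => i; apply: differentiable_bigsum => j.
exact: differentiableZl.
Qed.

Fact coord_is_linear m n i j : linear (fun M : 'M[K]_(m, n) => M i j : K^o).
Proof. by move=> a A B; rewrite !mxE. Qed.

Lemma diff_coord m n (M V : 'M[K]_(m, n)) i j :
  'd (fun N : 'M[K]_(m, n) => N i j : K) M V = V i j.
Proof.
pose f : {linear 'M[K]_(m, n) -> K^o} := HB.pack (fun M : 'M[K]_(m, n) => M i j : K^o)
  (GRing.isLinear.Build _ _ _ _ _ (@coord_is_linear m n i j)).
have -> : (fun N : 'M[K]_(m, n) => N i j : K) = f by [].
by rewrite diff_lin// => x; exact: coord_continuous.
Qed.

Lemma diff_mx (V : normedModType K) m n (f : V -> 'M[K]_(m, n)) x v i j :
  differentiable f x -> 'd f x v i j = 'd (fun y => f y i j : K) x v.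
Proof.
move=> df.
rewrite -[RHS]/('d ((fun M : 'M[K]_(m, n) => M i j : K) \o f) x v).
rewrite (diff_comp df (@differentiable_coord K m n (f x) i j)) /=.
by rewrite diff_coord.
Qed.

Lemma diff_eq_derive m n (f : 'M[K]_(m, n) -> K) X v : differentiable f X ->
  'd f X v = \tr ((\matrix_(j, i) 'D_(delta_mx i j) f X) *m v).
Proof.
move=> df; rewrite diff_sum_delta /mxtrace.
under [RHS]eq_bigr do rewrite mxE.
rewrite [RHS]exchange_big /=; apply: eq_bigr => i _; apply: eq_bigr => j _.
by rewrite mxE deriveE// mulrC.
Qed.

End Differentials.

Section SolidDifferential.
Variables (K : numFieldType) (n' : nat).
Local Notation n := n'.+1.
Implicit Types (X v : 'M[K]_n).

(** The gradient is transposed to match the convention that a covector pairs with $v$ through the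
    trace. *)
Definition cov (f : 'M[K]_n -> K) X : 'M[K]_n := \matrix_(j, i) 'D_(delta_mx i j) f X.

Lemma covE f X i j : cov f X j i = 'D_(delta_mx i j) f X.
Proof. by rewrite mxE. Qed.

Lemma diff_cov f X v : differentiable f X -> 'd f X v = \tr (cov f X *m v).
Proof. exact: diff_eq_derive. Qed.

Lemma cov_unique f X A : differentiable f X ->
  (forall v, 'd f X v = \tr (A *m v)) -> cov f X = A.
Proof.
move=> df fA; apply/matrixP => j i; rewrite mxE deriveE// fA.
by rewrite mxtrace_mulC mxtrace_delta.
Qed.

Lemma differentiable_solid p q m X : differentiable (@solid K n' p q m) X.
Proof.
pose s (Y : 'M[K]_n) := mxsub (@shift_ord n' m p) (@shift_ord n' m q) Y.
have ds : differentiable s X.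
  apply: differentiable_mx => i j; under eq_fun do rewrite mxE.
  exact: differentiable_coord.
have -> : @solid K n' p q m = (fun Z => \det Z) \o s by [].
apply: differentiable_comp => //; exact: differentiable_det.
Qed.

Lemma diff_solid p q m X v :
  'd (@solid K n' p q m) X v = \tr (solid_cov p q m X *m v).
Proof.
pose s (Y : 'M[K]_n) := mxsub (@shift_ord n' m p) (@shift_ord n' m q) Y.
have ds : differentiable s X.
  apply: differentiable_mx => i j; under eq_fun do rewrite mxE.
  exact: differentiable_coord.
have -> : @solid K n' p q m = (fun Z => \det Z) \o s by [].
rewrite (diff_comp ds (differentiable_det _)) /= diff_det.
have -> : 'd s X v = s v.
  apply/matrixP=> i j; rewrite diff_mx// /s mxE.
  by under eq_fun do rewrite mxE; rewrite diff_coord.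
rewrite /solid_cov /sub_cov -!mulmxA [RHS]mxtrace_mulC -!mulmxA; congr (\tr (_ *m _)).
by rewrite mulmx_colsub mulmx1 mul_rowsub_mx mul1mx; apply/matrixP=> i j; rewrite !mxE.
Qed.

Lemma differentiable_ham_val l k X : ham_den l k X != 0 ->
  differentiable (@ham_val K n' l k) X.
Proof.
move=> D0; apply: differentiableM; first exact: differentiable_solid.
by apply: differentiableV => //; exact: differentiable_solid.
Qed.

Lemma cov_ham_val l k X : ham_den l k X != 0 ->
  cov (@ham_val K n' l k) X = ham_cov l k X.
Proof.
move=> D0; apply: cov_unique => [|v]; first exact: differentiable_ham_val.
have dN := @differentiable_solid 0 (l - k) k X.
have dD := @differentiable_solid k 0 (l - k) X.
have -> : @ham_val K n' l k = (@ham_num K n' l k) * (fun Y => (ham_den l k Y)^-1) by [].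
rewrite diffM//; last exact: differentiableV.
rewrite diffV// /ham_cov -scalemxAl mulmxBl -!scalemxAl mxtraceZ raddfB /= !mxtraceZ.
rewrite -!diff_solid.
rewrite -[LHS]/(ham_num l k X * (- (ham_den l k X) ^- 2 * 'd (ham_den l k) X v)
  + (ham_den l k X)^-1 * 'd (ham_num l k) X v).
rewrite -/(ham_num l k) -/(ham_den l k).
move: ('d (ham_den l k) X v) ('d (ham_num l k) X v) => a b.
by field.
Qed.

Lemma near_ham_den_neq0 l k X : ham_den l k X != 0 ->
  \forall Y \near X, ham_den l k Y != 0.
Proof.
move=> D0; have cD : {for X, continuous (@ham_den K n' l k)}.
  by apply: differentiable_continuous; exact: differentiable_solid.
exact: (@cvgr_neq0 K K^o _ (nbhs X) _ (@ham_den K n' l k) _ cD D0).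
Qed.

End SolidDifferential.

Lemma ham_indexP m p : (p \in ham_index m) = (1 <= p.2 <= p.1)%N && (p.1 <= m)%N.
Proof.
case: p => l k; apply/allpairsPdep/idP => /= [[l' [k' [+ + [-> ->]]]]|h].
  by rewrite !mem_iota; lia.
by exists l, k; rewrite !mem_iota; split=> //; lia.
Qed.

Lemma uniq_ham_index m : uniq (ham_index m).
Proof.
apply: allpairs_uniq_dep => [|l _|]; rewrite ?iota_uniq//.
by move=> [l k] [l' k'] _ _ /= [-> ->].
Qed.

Lemma size_ham_index m : size (ham_index m) = (m.+1 * m)./2.
Proof.
rewrite size_allpairs_dep sumnE big_map.
under eq_bigr do rewrite size_iota.
elim: m => [|m IH]; first by rewrite big_nil.
have -> : (m.+2 * m.+1 = m.+1 * m + m.+1.*2)%N by nia.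
rewrite -[X in iota 1 X]addn1 iotaD big_cat /= big_seq1 IH halfD odd_double andbF.
by rewrite doubleK add0n add1n.
Qed.

Lemma pb_sum (K : comUnitRingType) n (X A B : 'M[K]_n) : pb X A B =
  \sum_(i < n) \sum_(k < n) \sum_(j < n) \sum_(l < n)
    (nsign K i k + nsign K j l) * X i l * X k j * A j i * B l k.
Proof.
rewrite /pb.
have row : \tr (sg (X *m A) *m (X *m B)) =
    \sum_(i < n) \sum_(k < n) \sum_(j < n) \sum_(l < n)
      nsign K i k * X i l * X k j * A j i * B l k.
  rewrite /mxtrace; under eq_bigr do rewrite mxE.
  rewrite exchange_big /=; apply: eq_bigr => i _; apply: eq_bigr => k _.
  rewrite [sg _ _ _]mxE [(X *m A) k i]mxE [(X *m B) i k]mxE.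
  rewrite [nsign _ _ _ * _]mulr_sumr mulr_suml; apply: eq_bigr => j _.
  by rewrite mulr_sumr; apply: eq_bigr => l _; ring.
have col : \tr (sg (A *m X) *m (B *m X)) =
    - \sum_(i < n) \sum_(k < n) \sum_(j < n) \sum_(l < n)
      nsign K j l * X i l * X k j * A j i * B l k.
  transitivity (\sum_(j < n) \sum_(l < n) \sum_(i < n) \sum_(k < n)
      - (nsign K j l * X i l * X k j * A j i * B l k)).
    rewrite /mxtrace; apply: eq_bigr => j _; rewrite mxE; apply: eq_bigr => l _.
    rewrite [sg _ _ _]mxE [(A *m X) j l]mxE [(B *m X) l j]mxE.
    rewrite [nsign _ _ _ * _]mulr_sumr mulr_suml; apply: eq_bigr => i _.
    rewrite mulr_sumr; apply: eq_bigr => k _.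
    by rewrite [nsign K l j]nsignC; ring.
  rewrite -sumrN; under [RHS]eq_bigr do rewrite -sumrN.
  under [RHS]eq_bigr do under eq_bigr do rewrite -sumrN.
  under [RHS]eq_bigr do under eq_bigr do under eq_bigr do rewrite -sumrN.
  rewrite pair_big [RHS]pair_big /=.
  under eq_bigr do rewrite pair_big /=.
  under [RHS]eq_bigr do rewrite pair_big /=.
  by rewrite exchange_big.
rewrite row col opprK -big_split; apply: eq_bigr => i _.
rewrite -big_split; apply: eq_bigr => k _; rewrite -big_split; apply: eq_bigr => j _.
by rewrite -big_split; apply: eq_bigr => l _ /=; ring.
Qed.

Section ClosedFieldDifferentials.
Variables (K : numClosedFieldType) (n' : nat).
Local Notation n := n'.+1.
Implicit Types (X v A : 'M[K]_n) (f g : 'M[K]_n -> K).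

Lemma sum_derive_pb f g X :
  \sum_(i < n) \sum_(k < n) \sum_(j < n) \sum_(l < n)
    (nsign K i k + nsign K j l) * X i l * X k j
    * 'D_(delta_mx i j) f X * 'D_(delta_mx k l) g X = pb X (cov f X) (cov g X).
Proof.
rewrite pb_sum; apply: eq_bigr => i _; apply: eq_bigr => k _.
apply: eq_bigr => j _; apply: eq_bigr => l _.
by rewrite -covE -covE.
Qed.

Lemma cov_coord (k l : 'I_n) X : cov (fun Y : 'M[K]_n => Y k l : K) X = delta_mx l k.
Proof.
apply: cov_unique => [|v]; first exact: differentiable_coord.
by rewrite diff_coord mxtrace_delta.
Qed.

Lemma pb_cov_coord X A (k l : 'I_n) :
  pb X A (cov (fun Y : 'M[K]_n => Y k l : K) X) = hamvec X A k l.
Proof. by rewrite pb_hamvec cov_coord mxtrace_delta. Qed.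

Lemma differentiable_mxtrace A X : differentiable (fun Y : 'M[K]_n => \tr (A *m Y) : K) X.
Proof.
rewrite /mxtrace; apply: differentiable_bigsum => i.
under eq_fun do rewrite mxE; apply: differentiable_bigsum => j.
by apply: differentiableM; [exact: differentiable_cst|exact: differentiable_coord].
Qed.

Lemma near_differentiable_mxtrace A X :
  \forall Y \near X, differentiable (fun Y : 'M[K]_n => \tr (A *m Y) : K) Y.
Proof. exact: (@filterE _ (nbhs X) _ _ (differentiable_mxtrace A)). Qed.

Lemma cov_mxtrace A X : cov (fun Y : 'M[K]_n => \tr (A *m Y) : K) X = A.
Proof.
apply: cov_unique => [|v]; first exact: differentiable_mxtrace.
have trl : linear (fun Y : 'M[K]_n => \tr (A *m Y) : K^o).
  by move=> a Y Z; rewrite mulmxDr -scalemxAr raddfD /= mxtraceZ.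
pose f : {linear 'M[K]_n -> K^o} := HB.pack (fun Y : 'M[K]_n => \tr (A *m Y) : K^o)
  (GRing.isLinear.Build _ _ _ _ _ trl).
have -> : (fun Y : 'M[K]_n => \tr (A *m Y) : K) = f by [].
rewrite diff_lin// => x; apply: differentiable_continuous.
exact: differentiable_mxtrace.
Qed.

Lemma pb_cov_ham_val l k m p X : (1 <= k <= l)%N -> (l <= n)%N ->
  (1 <= p <= m)%N -> (m <= n)%N -> ham_den l k X != 0 -> ham_den m p X != 0 ->
  pb X (cov (@ham_val K n' l k) X) (cov (@ham_val K n' m p) X) = 0.
Proof.
move=> kl ln pm mn Dp Dq; rewrite !cov_ham_val//.
case: (leqP l m) => lm; first by apply: pb_ham_cov; lia.
by rewrite pbC pb_ham_cov ?oppr0//; lia.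
Qed.

Lemma holomorphic_near_ham_val l k X : ham_den l k X != 0 ->
  \forall Y \near X, differentiable (@ham_val K n' l k) Y.
Proof.
by move=> /near_ham_den_neq0; apply: filterS => Y; exact: differentiable_ham_val.
Qed.

Lemma pb_cov_casimir k X A : (k <= n)%N -> ham_den n k X != 0 ->
  pb X (cov (@ham_val K n' n k) X) A = 0.
Proof.
by move=> kn D0; rewrite cov_ham_val// pb_hamvec hamvec_casimir// mulmx0 raddf0.
Qed.

End ClosedFieldDifferentials.

Section Bracket.
Variables (R : realType) (n' : nat).
Local Notation n := n'.+1.
Local Notation C := (C R).
Implicit Types (X v A : 'M[C]_n) (f g : 'M[C]_n -> C).

Lemma sign_nsign (i k : nat) : sign R (k%:Z - i%:Z) = nsign C i k.
Proof.
rewrite /sign /nsign; case: (ltngtP i k) => ik.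
- by rewrite gtr0_sgz ?subr0// subr_gt0 ltz_nat.
- by rewrite ltr0_sgz ?sub0r ?mulrN1z// subr_lt0 ltz_nat.
- by rewrite ik !subrr.
Qed.

Lemma bracket_pb f g X : bracket f g X = pb X (cov f X) (cov g X).
Proof.
etransitivity; last exact: (sum_derive_pb f g X).
apply: eq_bigr => i _; apply: eq_bigr => k _.
apply: eq_bigr => j _; apply: eq_bigr => l _.
by rewrite !sign_nsign.
Qed.

Lemma hamiltonian_vectorE f X : hamiltonian_vector f X = hamvec X (cov f X).
Proof.
apply/matrixP=> k l; etransitivity; first exact: mxE.
etransitivity; first exact: bracket_pb.
exact: pb_cov_coord.
Qed.

(** Every covector $A$ is the differential of the linear function $Y\mapsto\mathrm{tr}(AY)$, so
    function germs can be replaced by matrices. *)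
Lemma characteristicE X : characteristic X = range (hamvec X).
Proof.
apply/seteqP; split=> [_ [f _ ->]|_ [A _ <-]].
  by rewrite hamiltonian_vectorE; exists (cov f X).
exists (fun Y : 'M[C]_n => \tr (A *m Y)).
  exact: near_differentiable_mxtrace.
by rewrite hamiltonian_vectorE; congr (hamvec X); exact/esym/cov_mxtrace.
Qed.

Lemma hamE l k : (1 <= k <= l)%N -> (l <= n)%N -> @ham C n (l, k) = @ham_val C n' l k.
Proof. by move=> kl ln; apply/funext => X; exact: ham_ham_val. Qed.

Lemma bracket_ham p q X : p \in ham_index n -> q \in ham_index n ->
  ham_dom p X -> ham_dom q X -> bracket (@ham C n p) (@ham C n q) X = 0.
Proof.
case: p q => [l k] [m p]; rewrite !ham_indexP /= => /andP[kl ln] /andP[pm mn].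
move=> /(ham_dom_den X kl ln) Dp /(ham_dom_den X pm mn) Dq.
by rewrite bracket_pb !hamE//; exact: pb_cov_ham_val.
Qed.

Lemma casimir_ham k : (1 <= k <= n)%N ->
  casimir (@open_double_bruhat_cell C n) (@ham C n (n, k)).
Proof.
move=> kn X /open_double_bruhat_cellE[BX BXT]; rewrite hamE//.
have kn' : (k <= n)%N by case/andP: kn.
have D0 : ham_den n k X != 0 by exact: ham_den_neq0.
split; first exact: holomorphic_near_ham_val.
by move=> g _; rewrite bracket_pb; exact: pb_cov_casimir.
Qed.

End Bracket.

(** * Functions with zero differential on a connected complex domain *)

Section RealSegments.
Variables (R : realType) (K : numClosedFieldType).
(** For complex numbers these are the inclusion of the reals, the real part and the imaginary unit.
    The hypotheses reduce a holomorphic statement to the real mean value theorem along segments. *)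
Variables (iota : R -> K) (rho : K -> R) (im : K).
Hypothesis iotaD : forall a b, iota (a + b) = iota a + iota b.
Hypothesis iotaM : forall a b, iota (a * b) = iota a * iota b.
Hypothesis iota1 : iota 1 = 1.
Hypothesis iota_norm : forall r, `|iota r| = iota `|r|.
Hypothesis iota_lt : forall r s, (iota r < iota s) = (r < s).
Hypothesis iota_gt0 : forall e : K, 0 < e -> exists2 r, 0 < r & e = iota r.
Hypothesis rhoB : forall a b, rho (a - b) = rho a - rho b.
Hypothesis rho_norm : forall z, iota `|rho z| <= `|z|.
Hypothesis rhoZ : forall r z, rho (iota r * z) = r * rho z.
Hypothesis rho_eq0 : forall z, rho z = 0 -> rho (im * z) = 0 -> z = 0.

Let iota0 : iota 0 = 0.
Proof. by apply: (addIr (iota 0)); rewrite -iotaD !add0r. Qed.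

Let iotaN a : iota (- a) = - iota a.
Proof. by apply: (addIr (iota a)); rewrite -iotaD !addNr. Qed.

Let iotaV a : a != 0 -> iota a^-1 = (iota a)^-1.
Proof.
move=> a0; apply: (mulIf (_ : iota a != 0)).
  by apply: contra_eq_neq (congr1 iota (mulVf a0)) => E; rewrite iotaM E mulr0 iota1 eq_sym oner_eq0.
rewrite -iotaM mulVf// iota1 mulVf//.
by apply: contra_eq_neq (congr1 iota (mulVf a0)) => E; rewrite iotaM E mulr0 iota1 eq_sym oner_eq0.
Qed.

Lemma iota_continuous : continuous iota.
Proof.
move=> x; apply/cvgrPdist_lt => e /iota_gt0[r r0 ->]; near=> y.
rewrite -iotaN -iotaD iota_norm iota_lt.
by near: y; exact: (@cvgr_dist_lt _ _ _ (nbhs x) _ id x).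
Unshelve. all: by end_near. Qed.

Lemma rho_continuous : continuous rho.
Proof.
move=> x; apply/(@cvgrPdist_lt _ _ _ (nbhs x)) => e e0; near=> y.
rewrite -rhoB -iota_lt; apply: le_lt_trans (rho_norm _) _.
near: y; apply: (@cvgr_dist_lt _ _ _ (nbhs x) _ id x) => //.
by rewrite -iota0 iota_lt.
Unshelve. all: by end_near. Qed.

Lemma iota_neq0 r : r != 0 -> iota r != 0.
Proof.
move=> r0; apply: contra_eq_neq (congr1 iota (mulVf r0)) => E.
by rewrite iotaM E mulr0 iota1 eq_sym oner_eq0.
Qed.

Section Line.
Variables (V : normedModType K) (x y : V).

Definition line (t : R) : V := x + iota t *: (y - x).

Lemma line_continuous : continuous line.
Proof.
move=> t; apply: cvgD; first exact: cvg_cst.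
by apply: cvgZl; exact: iota_continuous.
Qed.

Lemma line0 : line 0 = x.
Proof. by rewrite /line iota0 scale0r addr0. Qed.

Lemma line1 : line 1 = y.
Proof. by rewrite /line iota1 scale1r addrC subrK. Qed.

(** The factor [c] is later taken to be 1 and [im], so that the real part [rho] sees both components
    of [f]. *)
Lemma is_derive_line (f : V -> K) (c : K) t : differentiable f (line t) ->
  'd f (line t) (y - x) = 0 ->
  is_derive t 1 (fun s => rho (c * f (line s))) 0.
Proof.
move=> df df0.
have H : h^-1 *: (f (h *: (y - x) + line t) - f (line t)) @[h --> (0 : K)^'] --> (0 : K).
  have dv : 'D_(y - x) f (line t) = 0 by rewrite deriveE.
  have := diff_derivable (v := y - x) df : _ --> 'D_(y - x) f (line t).
  by rewrite dv.
have io : iota h @[h --> (0 : R)^'] --> (0 : K)^'.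
  move=> P [e e0 Pe].
  have /(@cvgrPdist_lt _ _ _ (nbhs (0 : R)))/(_ e e0)[r r0 rP] := @iota_continuous 0.
  exists r => // h hr h0; apply: Pe; first by have := rP h hr; rewrite iota0.
  exact: iota_neq0.
have E : (fun h : R => h^-1 *: (rho (c * f (line (h *: 1 + t))) - rho (c * f (line t)))) =
    (fun h : R => rho (c * (iota h^-1 *: (f (iota h *: (y - x) + line t) - f (line t))))).
  apply/funext => h; have -> : line (h *: 1 + t) = iota h *: (y - x) + line t.
    by rewrite /line iotaD [_ *: 1]mulr1 scalerDl addrCA.
  rewrite -rhoB -mulrBr -[LHS]/(h^-1 * _) -rhoZ; congr rho.
  by rewrite -[X in c * X]/(iota h^-1 * _) mulrCA.
have L : h^-1 *: (rho (c * f (line (h *: 1 + t))) - rho (c * f (line t))) @[h --> (0 : R)^'] --> (0 : R).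
  rewrite E.
  have L0 : iota h^-1 *: (f (iota h *: (y - x) + line t) - f (line t))
      @[h --> (0 : R)^'] --> (0 : K).
    apply: cvg_trans (cvg_comp _ _ io H).
    apply: near_eq_cvg; near=> h; rewrite /= iotaV//.
    by near: h; exact: nbhs_dnbhs_neq.
  have L1 : c * (iota h^-1 *: (f (iota h *: (y - x) + line t) - f (line t)))
      @[h --> (0 : R)^'] --> c * 0.
    by apply: cvgM L0; exact: cvg_cst.
  have rho0 : rho (c * 0) = 0 by rewrite mulr0 -(subrr (0 : K)) rhoB subrr.
  have := cvg_comp _ _ L1 (@rho_continuous (c * 0)).
  by rewrite rho0.
by split; [apply: cvgP L|apply: cvg_lim L].
Unshelve. all: by end_near. Qed.

Lemma eq_of_diff_eq0_segment (f : V -> K) :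
  (forall t, 0 <= t <= 1 -> differentiable f (line t) /\ 'd f (line t) = 0 :> (V -> K)) ->
  f x = f y.
Proof.
move=> h; rewrite -line0 -line1; apply/eqP; rewrite -subr_eq0; apply/eqP.
have key c : rho (c * f (line 1)) = rho (c * f (line 0)).
  pose u (s : R) : R := rho (c * f (line s)).
  have der (t : R) : 0 <= t <= 1 -> is_derive t 1 u 0.
    by move=> /h[df d0]; apply: is_derive_line; rewrite ?d0.
  have du (t : R) : t \in `]0, 1[%R -> is_derive t 1 u ((fun=> 0) t).
    by move=> t01; apply: der; rewrite !ltW ?(itvP t01).
  have cu : {within `[0, 1], continuous u}.
    apply: derivable_within_continuous => t t01.
    by case: (der t); rewrite ?(itvP t01).
  have [c0 _] := MVT_segment (ler01 : 0 <= 1 :> R) du cu.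
  by rewrite mul0r => /eqP; rewrite subr_eq0 => /eqP.
apply: rho_eq0; first by have := key 1; rewrite !mul1r rhoB => ->; rewrite subrr.
by rewrite mulrBr rhoB key subrr.
Qed.

End Line.

Lemma line_ball (V : normedModType K) (x y : V) (e : K) t : 0 < e -> ball x e y ->
  0 <= t <= 1 -> ball x e (line x y t).
Proof.
move=> e0; rewrite -!ball_normE /ball_ /= => xy /andP[t0 t1].
rewrite /line opprD addNKr normrN normrZ iota_norm ger0_norm// distrC.
apply: le_lt_trans xy; rewrite ler_piMl//.
move: t1; rewrite le_eqVlt => /orP[/eqP->|t1]; first by rewrite iota1.
by rewrite -iota1 ltW// iota_lt.
Qed.

Lemma ball_connected (V : normedModType K) (x : V) (e : K) : 0 < e -> connected (ball x e).
Proof.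
move=> e0.
have -> : ball x e = \bigcup_(y in ball x e) (line x y @` `[0, 1]).
  apply/seteqP; split=> [y xy|_ [y xy [t t01 <-]]].
    by exists y => //; exists 1; rewrite /= ?in_itv /= ?ler01 ?lexx ?line1.
  by apply: line_ball => //; move: t01; rewrite /= in_itv.
apply: bigcup_connected.
  by exists x => y _; exists 0; rewrite /= ?in_itv /= ?ler01 ?lexx ?line0.
move=> y _; apply: connected_continuous_connected; first exact: segment_connected.
by apply: continuous_subspaceT; exact: line_continuous.
Qed.

(** By the segment case [f] is locally constant, so the level set of [f x] in [A] and its complement
    in [A] are both open; connectedness concludes. *)
Lemma eq_of_diff_eq0 (V : normedModType K) (A : set V) (f : V -> K) :
  open A -> connected A ->
  (forall x, A x -> differentiable f x /\ 'd f x = 0 :> (V -> K)) ->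
  forall x y, A x -> A y -> f x = f y.
Proof.
move=> oA cA df x y Ax Ay.
have loc z : A z -> exists2 e : K, 0 < e & ball z e `<=` A `&` [set u | f z = f u].
  move=> Az; have /nbhs_ballP[e e0 zA] : nbhs z A by apply: open_nbhs_nbhs.
  exists e => // u zu; split; first exact: zA.
  apply: eq_of_diff_eq0_segment => t t01; apply: df; apply: zA.
  exact: line_ball.
have openL P : open (A `&` [set z | P (f z)]).
  rewrite openE => z [Az Pz]; have [e e0 h] := loc z Az.
  by apply/nbhs_ballP; exists e => // u /h[Au fu]; split=> //=; rewrite -fu.
have : A `&` [set z | f x = f z] = A; last first.
  by move=> E; move: Ay; rewrite -E => -[].
apply: cA; first by exists x.
  by exists (A `&` [set z | f x = f z]); rewrite ?setIA ?setIid//; exact: (openL (fun w => f x = w)).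
exists (~` (A `&` [set z | f x <> f z])).
  by apply: open_closedC; exact: (openL (fun w => f x <> w)).
apply/seteqP; split=> z [Az /= h]; split=> //=; first by move=> -[].
by apply: contrapT => n; apply: h.
Qed.

End RealSegments.

Section ComplexConnectedness.
Variable R : realType.
Local Notation C := (C R).

Let iota (r : R) : C := (r%:C)%C.
Let rho (z : C) : R := complex.Re z.

Let iotaD a b : iota (a + b) = iota a + iota b.
Proof. exact: (rmorphD (real_complex R)). Qed.
Let iotaM a b : iota (a * b) = iota a * iota b.
Proof. exact: (rmorphM (real_complex R)). Qed.
Let iota1 : iota 1 = 1. Proof. by []. Qed.
Let iota_norm r : `|iota r| = iota `|r|.
Proof. by etransitivity; [exact: normc_def|rewrite /= expr0n addr0 sqrtr_sqr]. Qed.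
Let iota_lt r s : (iota r < iota s) = (r < s).
Proof. exact: ltcR. Qed.
Let iota_gt0 (e : C) : 0 < e -> exists2 r, 0 < r & e = iota r.
Proof.
case: e => a b; rewrite [X in is_true X -> _]ltcE /= => /andP[/eqP b0 a0].
by exists a => //; rewrite b0.
Qed.
Let rhoB a b : rho (a - b) = rho a - rho b.
Proof. by case: a b => [a1 a2] [b1 b2]. Qed.
Let rho_norm z : iota `|rho z| <= `|z|.
Proof.
change (is_true (((`|complex.Re z|)%:C)%C <= `|(z : R[i])|)).
by rewrite normc_def lecR -sqrtr_sqr ler_wsqrtr// lerDl sqr_ge0.
Qed.
Let rhoZ r z : rho (iota r * z) = r * rho z.
Proof. by case: z => a b; rewrite /rho /= mul0r subr0. Qed.
Let im : C := Complex 0 1.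
Let rho_eq0 z : rho z = 0 -> rho (im * z) = 0 -> z = 0.
Proof.
by case: z => a b; rewrite /rho /= mul0r mul1r sub0r => -> /eqP; rewrite oppr_eq0 => /eqP->.
Qed.

Lemma complex_ball_connected (V : normedModType C) (x : V) (e : C) :
  0 < e -> connected (ball x e).
Proof. by move=> e0; apply: (ball_connected iotaD). Qed.

Lemma complex_eq_of_diff_eq0 (V : normedModType C) (A : set V) (f : V -> C) :
  open A -> connected A ->
  (forall x, A x -> differentiable f x /\ 'd f x = 0 :> (V -> C)) ->
  forall x y, A x -> A y -> f x = f y.
Proof.
exact: (eq_of_diff_eq0 iotaD iotaM iota1 iota_norm iota_lt iota_gt0 rhoB rho_norm rhoZ rho_eq0).
Qed.

End ComplexConnectedness.

(** * Nonvanishing of initial minors on the leaves *)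

Section RankLocus.
Variables (K : numClosedFieldType).

(** The adjugate of $\mathrm{diag}(1,\dots,1,0)$ is the matrix unit of the last corner: its product
    with this singular matrix is zero on either side. By Jacobi's formula, the differential of the
    determinant there reads off the corner entry. *)
Lemma adj_pid_mx_corner r (Z : 'M[K]_r.+1) :
  \tr (\adj (pid_mx r : 'M[K]_r.+1) *m Z) = Z ord_max ord_max.
Proof.
have d0 : \det (pid_mx r : 'M[K]_r.+1) = 0.
  rewrite det_trig; last first.
    by apply/is_trig_mxP => i j ij; rewrite mxE (ltn_eqF ij).
  by rewrite (bigD1 ord_max)//= mxE ltnn andbF mul0r.
have pidE (M : 'M[K]_r.+1) (i j : 'I_r.+1) : (i < r)%N ->
    ((pid_mx r : 'M[K]_r.+1) *m M) i j = M i j /\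
    (M *m (pid_mx r : 'M[K]_r.+1)) j i = M j i.
  move=> ir; split.
    rewrite mxE (bigD1 i)//= big1 => [|k ki]; first by rewrite mxE eqxx ir mul1r addr0.
    by rewrite mxE (_ : (i == k :> nat) = false) ?mul0r// eq_sym; exact: (negPf ki).
  rewrite mxE (bigD1 i)//= big1 => [|k ki]; first by rewrite mxE eqxx ir mulr1 addr0.
  by rewrite mxE (_ : (k == i :> nat) = false) ?mulr0//; exact: (negPf ki).
have adj0 (i j : 'I_r.+1) : (i != ord_max) || (j != ord_max) ->
    \adj (pid_mx r : 'M[K]_r.+1) i j = 0.
  have lt (k : 'I_r.+1) : k != ord_max -> (k < r)%N.
    by rewrite -val_eqE /= => kr; have := ltn_ord k; rewrite ltnS leq_eqVlt (negPf kr).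
  case/orP => /lt h.
    have [<- _] := pidE (\adj (pid_mx r : 'M[K]_r.+1)) i j h.
    by rewrite mul_mx_adj d0 mxE mul0rn.
  have [_ <-] := pidE (\adj (pid_mx r : 'M[K]_r.+1)) j i h.
  by rewrite mul_adj_mx d0 mxE mul0rn.
rewrite /mxtrace (bigD1 ord_max)//= big1 ?addr0 => [|i im].
  rewrite mxE (bigD1 ord_max)//= big1 ?addr0 => [|j jm]; last first.
    by rewrite adj0 ?mul0r// jm orbT.
  suff -> : \adj (pid_mx r : 'M[K]_r.+1) ord_max ord_max = 1 by rewrite mul1r.
  rewrite mxE /cofactor addnn -signr_odd odd_double mul1r.
  have -> : row' ord_max (col' ord_max (pid_mx r : 'M[K]_r.+1)) = 1%:M.
    apply/matrixP=> i j; rewrite !mxE !lift_max -val_eqE /= ltn_ord andbT.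
    by [].
  exact: det1.
by rewrite mxE big1 // => j _; rewrite adj0 ?mul0r// im.
Qed.

Lemma differentiable_linear_mx m n (W : normedModType K)
    (f : {linear 'M[K]_(m, n) -> W}) X : differentiable f X.
Proof.
have -> : (f : 'M[K]_(m, n) -> W) = fun Y => \sum_i \sum_j Y i j *: f (delta_mx i j).
  apply/funext => Y; rewrite {1}[Y]matrix_sum_delta linear_sum; apply: eq_bigr => i _.
  by rewrite linear_sum; apply: eq_bigr => j _; rewrite linearZ.
apply: differentiable_bigsum => i; apply: differentiable_bigsum => j.
by apply: differentiableZl; exact: differentiable_coord.
Qed.

Lemma diff_linear_mx m n (W : normedModType K) (f : {linear 'M[K]_(m, n) -> W}) X :
  'd f X = f :> ('M[K]_(m, n) -> W).
Proof.
by rewrite diff_lin// => Y; apply: differentiable_continuous; exact: differentiable_linear_mx.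
Qed.

Lemma diff_comp_linear_mx m n (V W : normedModType K) (S : V -> 'M[K]_(m, n))
    (f : {linear 'M[K]_(m, n) -> W}) v w : differentiable S v ->
  differentiable (f \o S) v /\ 'd (f \o S) v w = f ('d S v w).
Proof.
move=> dS; split; first by apply: differentiable_comp => //; exact: differentiable_linear_mx.
by rewrite (diff_comp dS (@differentiable_linear_mx _ _ _ f _)) /= diff_linear_mx.
Qed.

(* A family of square matrices that is singular on an open set moves, at a
   point of maximal rank, only in directions that send the kernel into the
   image. *)
Lemma singular_family (V : normedModType K) (W : set V) k (S : V -> 'M[K]_k) :
  open W -> W !=set0 -> (forall v, W v -> differentiable S v) ->
  (forall v, W v -> \det (S v) = 0) ->
  exists v, W v /\ exists (xi : 'rV[K]_k) (eta : 'cV[K]_k),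
    [/\ xi != 0, eta != 0, xi *m S v = 0, S v *m eta = 0
      & forall w, xi *m 'd S v w *m eta = 0].
Proof.
move=> oW [v1 Wv1] dS S0.
pose Pr r := `[< exists2 v, W v & \rank (S v) = r >].
have exP : exists r, Pr r by exists (\rank (S v1)); apply/asboolP; exists v1.
have ubP r : Pr r -> (r <= k)%N by move=> /asboolP[v _ <-]; exact: rank_leq_row.
have [r /asboolP[v Wv rv] rmax] := ex_maxnP exP ubP.
have rk : (r < k)%N.
  rewrite ltn_neqAle -rv rank_leq_row andbT; apply/negP => /eqP full.
  have : S v \in unitmx by rewrite -row_free_unit -row_leq_rank full.
  by rewrite unitmxE unitfE S0// eqxx.
exists v; split=> //.
pose P := invmx (col_ebase (S v)); pose Q := invmx (row_ebase (S v)).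
have uP : P \in unitmx by rewrite unitmx_inv col_ebase_unit.
have uQ : Q \in unitmx by rewrite unitmx_inv row_ebase_unit.
have PSQ : P *m S v *m Q = pid_mx r.
  rewrite -{1}(mulmx_ebase (S v)) rv /P /Q !mulmxA mulVmx ?col_ebase_unit// mul1mx.
  by rewrite mulmxK ?row_ebase_unit.
pose f (i : 'I_r.+1) : 'I_k := widen_ord rk i.
pose A := rowsub f P; pose B := colsub f Q.
pose ir := f ord_max.
have PS : row ir P *m S v = 0.
  apply: (can_inj (mulmxK uQ)); rewrite mul0mx -!row_mul PSQ.
  by apply/matrixP=> i j; rewrite !mxE ltnn andbF.
have SQ : S v *m col ir Q = 0.
  apply: (can_inj (mulKmx uP)); rewrite mulmx0 colE !mulmxA PSQ -colE.
  apply/matrixP=> i j; rewrite !mxE /=; case: eqP => //= ->.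
  by rewrite ltnn.
exists (row ir P), (col ir Q); split=> //.
- apply/eqP => /(congr1 (mulmxr (invmx P))); rewrite /= -row_mul mulmxV// mul0mx.
  by move=> /matrixP/(_ 0 ir); rewrite !mxE eqxx => /eqP; rewrite oner_eq0.
- apply/eqP => /(congr1 (mulmx (invmx Q))); rewrite colE mulmxA mulVmx// mul1mx mulmx0.
  by move=> /matrixP/(_ ir 0); rewrite !mxE eqxx => /eqP; rewrite oner_eq0.
move=> w.
(* A minor of size $r+1$ in bases where [S v] is [pid_mx r]. It vanishes on [W] by maximality of
   [r], and its differential at [v] is the corner entry $\xi\,dS(w)\,\eta$. *)
pose h u := \det (A *m S u *m B).
have h0 u : W u -> h u = 0.
  move=> Wu; apply/eqP/negPn/negP; rewrite -unitfE -unitmxE -row_free_unit -row_leq_rank => full.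
  have : (r < r)%N; last by rewrite ltnn.
  apply: leq_trans full (leq_trans (mxrankM_maxl _ _) (leq_trans (mxrankM_maxr _ _) _)).
  by apply: rmax; apply/asboolP; exists u.
pose T u := A *m S u *m B.
have linL : linear (fun M : 'M[K]_k => A *m M *m B).
  by move=> a M M'; rewrite mulmxDr mulmxDl -scalemxAr -scalemxAl.
pose L : {linear 'M[K]_k -> 'M[K]_r.+1} := HB.pack (fun M : 'M[K]_k => A *m M *m B)
  (GRing.isLinear.Build _ _ _ _ _ linL).
have [dT dTE] : differentiable T v /\ 'd T v w = A *m 'd S v w *m B.
  exact: (diff_comp_linear_mx L w (dS v Wv)).
have TE : T v = pid_mx r.
  rewrite /T /A /B mul_rowsub_mx mulmx_colsub mul_rowsub_mx PSQ.
  by apply/matrixP=> i j; rewrite !mxE.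
have : 'd h v w = 0.
  rewrite -deriveE; last exact: differentiable_comp dT (differentiable_det _).
  rewrite (@near_eq_derive K V K^o h (cst 0)) ?derive_cst//.
  exact: (filterS h0 (open_nbhs_nbhs (conj oW Wv))).
rewrite -[h]/((fun M => \det M) \o T).
rewrite (diff_comp dT (differentiable_det _)) /= diff_det TE adj_pid_mx_corner dTE => E.
apply/matrixP=> a b; rewrite !ord1 [RHS]mxE -E.
rewrite /A /B mul_rowsub_mx mulmx_colsub mul_rowsub_mx colE mulmxA -!row_mul -colE.
by rewrite !mxE.
Qed.

End RankLocus.

Section Charts.
Variables (K : numClosedFieldType) (n' : nat).
Local Notation n := n'.+1.
Local Notation M := 'M[K]_n.

Definition tangent_chart d (V : set 'rV[K]_d) (phi : 'rV[K]_d -> M) : Prop :=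
  open V /\ forall v, V v ->
    [/\ differentiable phi v, bruhat_minus (phi v), bruhat_minus (phi v)^T
      & range ('d phi v) = range (hamvec (phi v))].

Lemma solid_neq0_on_chart d (W : set 'rV[K]_d) (psi : 'rV[K]_d -> M) l k :
  open W -> W !=set0 -> (k <= l <= n)%N ->
  (forall v, W v -> [/\ differentiable psi v, bruhat_minus (psi v)
     & forall A, exists w, 'd psi v w = hamvec (psi v) A]) ->
  exists v, W v /\ solid 0 (l - k) k (psi v) != 0.
Proof.
move=> oW W0 kl Wpsi; apply: contrapT => nex.
pose c := @shift_ord n' k (l - k); pose r := @shift_ord n' k 0.
have linS : linear (fun X : M => mxsub r c X) by move=> a X Y; apply/matrixP=> i j; rewrite !mxE.
pose L : {linear M -> 'M[K]_k} := HB.pack (fun X : M => mxsub r c X)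
  (GRing.isLinear.Build _ _ _ _ _ linS).
pose S := L \o psi.
have dS v w : W v -> differentiable S v /\ 'd S v w = mxsub r c ('d psi v w).
  by move=> /Wpsi[dpsi _ _]; exact: (diff_comp_linear_mx L w dpsi).
have S0 v : W v -> \det (S v) = 0.
  by move=> Wv; apply/eqP/negPn/negP => h; apply: nex; exists v.
have [v [Wv [xi [eta [xi0 eta0 xiS Seta H]]]]] :=
  singular_family oW W0 (fun v Wv => (dS v 0 Wv).1) S0.
have [dpsi Bpsi surj] := Wpsi v Wv.
have rE (i : 'I_k) : r i = i :> nat by rewrite val_shift_ord//; lia.
have cE (i : 'I_k) : c i = (l - k + i)%N :> nat by rewrite val_shift_ord//; lia.
apply: (@hamvec_bilinear_neq0 K n' (psi v) k l (xi *m rowsub r 1%:M) (colsub c 1%:M *m eta)) => //.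
- move=> i ki; rewrite mxE big1 // => a _; rewrite !mxE; case: eqP => [e|]; rewrite ?mulr0//.
  by move: (ltn_ord a); rewrite -(rE a) e; lia.
- apply: contraNneq xi0 => /(congr1 (fun u => u *m colsub r 1%:M)).
  rewrite mul0mx -mulmxA mulmx_colsub mulmx1 => E; apply/eqP; rewrite -[RHS]E.
  have -> : colsub r (rowsub r 1%:M) = 1%:M :> 'M[K]_k.
    by apply/matrixP=> a b; rewrite !mxE -!val_eqE /= !rE.
  by rewrite mulmx1.
- move=> j nj; rewrite mxE big1 // => a _; rewrite !mxE; case: eqP => [e|]; rewrite ?mul0r//.
  by move: (ltn_ord a) nj; rewrite e cE; lia.
- apply: contraNneq eta0 => /(congr1 (fun u => rowsub c 1%:M *m u)).
  rewrite mulmx0 mulmxA mul_rowsub_mx mul1mx => E; apply/eqP; rewrite -[RHS]E.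
  have -> : rowsub c (colsub c 1%:M) = 1%:M :> 'M[K]_k.
    by apply/matrixP=> a b; rewrite !mxE -!val_eqE /= !cE; congr (_%:R); lia.
  by rewrite mul1mx.
- move=> j lj; have jk : (j - (l - k) < k)%N by lia.
  have -> : j = c (Ordinal jk) by apply: ord_inj; rewrite cE /=; lia.
  transitivity ((xi *m S v) 0 (Ordinal jk)); last by rewrite xiS mxE.
  by rewrite -mulmxA mul_rowsub_mx mul1mx !mxE; apply: eq_bigr => a _; rewrite !mxE.
- move=> i ik; have -> : i = r (Ordinal ik) by apply: ord_inj; rewrite rE.
  transitivity ((S v *m eta) (Ordinal ik) 0); last by rewrite Seta mxE.
  by rewrite mulmxA mulmx_colsub mulmx1 !mxE; apply: eq_bigr => a _; rewrite !mxE.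
move=> A; have [w Aw] := surj A.
rewrite -(H w) (dS v w Wv).2 Aw -!mulmxA; congr (xi *m _).
rewrite !mulmxA mul_rowsub_mx mul1mx mulmx_colsub mulmx1; congr (_ *m _).
by apply/matrixP=> a b; rewrite !mxE.
Qed.

Definition initial_minors_neq0 (X : M) : Prop :=
  forall p m, (p + m <= n)%N -> solid 0 p m X != 0 /\ solid p 0 m X != 0.

(** A finite intersection of dense open sets: [W] is shrunk to where the functions treated so far
    are nonzero, which is why the density hypothesis ranges over all open subsets. *)
Lemma nonvanishing_seq d (W : set 'rV[K]_d) (I : Type) (s : seq I) (F : I -> 'rV[K]_d -> K) :
  open W -> W !=set0 -> (forall i v, W v -> differentiable (F i) v) ->
  (forall i (W' : set 'rV[K]_d), open W' -> W' `<=` W -> W' !=set0 ->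
     exists v, W' v /\ F i v != 0) ->
  exists v, W v /\ all (fun i => F i v != 0) s.
Proof.
move=> oW W0 dF h; elim: s W oW W0 dF h => [|i s IH] W oW [v0 Wv0] dF h.
  by exists v0.
have [v1 [Wv1 Fv1]] := h i W oW (fun=> id) (ex_intro _ _ Wv0).
pose W' := [set v | W v /\ F i v != 0].
have oW' : open W'.
  rewrite openE => v [Wv Fv]; apply: filterI; first exact: open_nbhs_nbhs.
  have cF : {for v, continuous (F i)} by apply: differentiable_continuous; exact: dF.
  exact: (@cvgr_neq0 K K^o _ (nbhs v) _ (F i) _ cF Fv).
have [|||v [[Wv Fv] sv]] := IH W' oW'; first by exists v1.
- by move=> j v [Wv _]; exact: dF.
- by move=> j W'' oW'' sW; apply: h => // v /sW[].
by exists v; split=> //=; rewrite Fv.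
Qed.

Lemma initial_minors_neq0_on_chart d (V W : set 'rV[K]_d) (phi : 'rV[K]_d -> M) :
  tangent_chart V phi -> open W -> W `<=` V -> W !=set0 ->
  exists v, W v /\ initial_minors_neq0 (phi v).
Proof.
move=> [oV hV] oW WV W0.
pose idx := [seq (b, pm) | b <- [:: true; false],
                            pm <- [seq (p, m) | p <- iota 0 n.+1, m <- iota 0 n.+1]].
pose F (i : bool * (nat * nat)) v : K := let: (b, (p, m)) := i in
  if (p + m <= n)%N then (if b then solid 0 p m (phi v) else solid p 0 m (phi v)) else 1.
have surj v : V v -> forall A, exists w, 'd phi v w = hamvec (phi v) A.
  move=> /hV[_ _ _ E] A; have : range (hamvec (phi v)) (hamvec (phi v) A) by exists A.
  by rewrite -E => -[w _ <-]; exists w.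
have [|i W' oW' sW W'0|v [Wv hv]] := @nonvanishing_seq d W _ idx F oW W0.
- move=> [b [p m]] v /WV /hV[dphi _ _ _]; rewrite /F; case: (p + m <= n)%N; last exact: differentiable_cst.
  case: b; exact: (differentiable_comp dphi (differentiable_solid _ _ _ _)).
- case: i => b [p m]; rewrite /F; case: (boolP (p + m <= n)%N) => [pm|_]; last first.
    by have [v W'v] := W'0; exists v; rewrite oner_eq0.
  have pml : (m <= p + m <= n)%N by rewrite leq_addl.
  case: b.
    have [v W'v|v [W'v]] := @solid_neq0_on_chart d W' phi _ _ oW' W'0 pml.
      by have Vv := WV v (sW v W'v); have [dphi B _ _] := hV v Vv; split=> //; exact: surj.
    by rewrite addnK; exists v.
  (* The minors in the first columns are those in the first rows of the transposed chart, which is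
     still tangent by [tr_hamvec]. *)
  have [v W'v|v [W'v]] := @solid_neq0_on_chart d W' (trmx \o phi) _ _ oW' W'0 pml.
    have Vv := WV v (sW v W'v); have [dphi _ B _] := hV v Vv; split=> //.
      by have [] := diff_comp_linear_mx trmx 0 dphi.
    move=> A; have [w wA] := surj v Vv A^T; exists w.
    have [_ ->] := diff_comp_linear_mx trmx w dphi.
    by rewrite /= wA -tr_hamvec trmxK.
  by rewrite addnK /= solid_tr; exists v.
exists v; split=> // p m pm.
have mem (b : bool) : (b, (p, m)) \in idx.
  apply/allpairsP; exists (b, (p, m)); split=> //; first by case: (b); rewrite !inE.
  by apply/allpairsP; exists (p, m); rewrite !mem_iota; split=> //=; lia.
have := allP hv _ (mem true); have := allP hv _ (mem false).
by rewrite /F pm.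
Qed.

Lemma ham_index_cat : ham_index n = ham_index n' ++ [seq (n, k) | k <- iota 1 n].
Proof.
rewrite /ham_index [in LHS](_ : iota 1 n = iota 1 n' ++ [:: n]).
  by rewrite map_cat flatten_cat /= cats0.
by rewrite -[in LHS](addn1 n') iotaD add1n.
Qed.

(** A relation among the restricted differentials gives a covector vanishing on the image of the
    Poisson tensor, hence in its kernel by skewness, hence a combination of Casimir covectors. This
    is a relation among all $H(l,k)$ with $l\le n$ on the whole matrix space, where
    [ham_cov_independent] applies. *)
Lemma ham_independent_on_chart d (V : set 'rV[K]_d) (phi : 'rV[K]_d -> M) v :
  tangent_chart V phi -> V v -> initial_minors_neq0 (phi v) ->
  (forall p, p \in ham_index n' -> differentiable (@ham_val K n' p.1 p.2 \o phi) v) /\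
  forall c : nat * nat -> K,
    (forall w, \sum_(p <- ham_index n') c p * 'd (@ham_val K n' p.1 p.2 \o phi) v w = 0) ->
    forall p, p \in ham_index n' -> c p = 0.
Proof.
move=> [oV hV] Vv good; have [dphi BX BXT rng] := hV v Vv.
have den0 p : p \in ham_index n' -> ham_den p.1 p.2 (phi v) != 0.
  by rewrite ham_indexP => h; have [] := good p.2 (p.1 - p.2)%N ltac:(lia).
have dham p : p \in ham_index n' -> differentiable (@ham_val K n' p.1 p.2) (phi v).
  by move=> /den0; exact: differentiable_ham_val.
split=> [p /dham dp|c hc p0 p0s]; first exact: differentiable_comp.
pose B := \sum_(p <- ham_index n') c p *: ham_cov p.1 p.2 (phi v).
have B0 : hamvec (phi v) B = 0.
  apply: mxtrace_nondegenerate => A; rewrite -pb_hamvec pbC pb_hamvec.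
  have : range (hamvec (phi v)) (hamvec (phi v) A) by exists A.
  rewrite -rng => -[w _ <-]; apply/eqP; rewrite oppr_eq0; apply/eqP.
  rewrite -[RHS](hc w) mulmx_suml raddf_sum /= big_seq [RHS]big_seq.
  apply: eq_bigr => p ps; rewrite -scalemxAl mxtraceZ; congr (_ * _).
  by rewrite (diff_comp dphi (dham p ps)) /= diff_cov ?cov_ham_val ?den0//; exact: dham.
have [e Be] := hamvec_ker_casimir BX BXT B0.
(* The Casimir combination is moved to the other side; [e] is indexed from 0 whereas $k$ starts at
   1. *)
pose c' (p : nat * nat) := if p.1 == n then - e (inord p.2.-1) else c p.
suff : c' p0 = 0.
  rewrite /c'; case: eqP => // p0n; move: p0s; rewrite ham_indexP p0n ltnn andbF.
  by [].
apply: (@ham_cov_independent K n' (phi v) (ham_index n) c' good (uniq_ham_index n)).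
- by move=> p; rewrite ham_indexP.
- rewrite ham_index_cat big_cat.
  rewrite -[LHS]/(\sum_(p <- ham_index n') c' p *: ham_cov p.1 p.2 (phi v) +
    \sum_(p <- [seq (n, k) | k <- iota 1 n]) c' p *: ham_cov p.1 p.2 (phi v)).
  have -> : \sum_(p <- ham_index n') c' p *: ham_cov p.1 p.2 (phi v) = B.
    rewrite /B big_seq [RHS]big_seq; apply: eq_bigr => p; rewrite ham_indexP /c' => h.
    by have -> : (p.1 == n) = false by lia.
  have -> : iota 1 n = [seq i.+1 | i <- index_iota 0 n].
    by rewrite /index_iota subn0 -[in LHS](addn0 1%N) iotaDl.
  rewrite !big_map Be big_mkord -big_split big1 // => k _.
  by rewrite /c' /= eqxx inord_val scaleNr addrN.
by rewrite ham_index_cat mem_cat p0s.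
Qed.

End Charts.

(** * Charts of the leaves *)

Section SquareRoot.
Variable K : numClosedFieldType.

(* The holomorphic branch of the square root near 1 with value 1 at 1. *)
Definition sqrt1 (z : K) : K :=
  if `|sqrtC z - 1| <= `|sqrtC z + 1| then sqrtC z else - sqrtC z.

Lemma sqrt1_sqr z : sqrt1 z ^+ 2 = z.
Proof. by rewrite /sqrt1; case: ifP => _; rewrite ?sqrrN sqrtCK. Qed.

Lemma sqrt1_le z : `|sqrt1 z - 1| <= `|sqrt1 z + 1|.
Proof.
rewrite /sqrt1; case: ifP => // /negbT; rewrite -real_ltNge ?normr_real// => /ltW.
by rewrite -opprD normrN [- _ + 1]addrC distrC.
Qed.

(** With $w$ the root, $2=(w+1)-(w-1)$ and [sqrt1_le] give $|w+1|\ge1$, and $z-1=(w-1)(w+1)$. *)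
Lemma sqrt1_dist z : `|sqrt1 z - 1| <= `|z - 1|.
Proof.
set w := sqrt1 z; have w1 : 1 <= `|w + 1|.
  have : `|(w + 1) - (w - 1)| <= `|w + 1| + `|w + 1|.
    by apply: le_trans (ler_normB _ _) _; rewrite lerD2l; exact: sqrt1_le.
  have -> : (w + 1) - (w - 1) = 2%:R by ring.
  rewrite (normr_nat K 2).
  by rewrite -mulr2n -[X in X <= _]mul1r mulr_natr lerMn2r.
have -> : z - 1 = (w - 1) * (w + 1) by rewrite -subr_sqr expr1n sqrt1_sqr.
by rewrite normrM ler_peMr.
Qed.

Lemma sqrt1_1 : sqrt1 1 = 1.
Proof.
have := sqrt1_dist 1; rewrite subrr normr0 normr_le0 subr_eq0 => /eqP //.
Qed.

(** With radius $1/2$ the sum of two values of [sqrt1] stays within distance 1 of 2. This bounds the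
    denominator in [sqrt1_sub] away from 0 and gives continuity and the derivative. *)
Definition sqrt1_dom : set K := [set z | `|z - 1| < 2^-1].

Lemma sqrt1_neq0 z : sqrt1_dom z -> sqrt1 z != 0.
Proof.
move=> z1; apply/eqP => E; have := sqrt1_dist z; rewrite E sub0r normrN1.
move=> h; have := lt_le_trans (le_lt_trans h z1) (_ : 2^-1 <= 1 :> K).
by rewrite ltxx invf_le1 ?ltr0n// ler1n => /(_ isT).
Qed.

Lemma sqrt1_add_ge1 y z : sqrt1_dom y -> sqrt1_dom z -> 1 <= `|sqrt1 y + sqrt1 z|.
Proof.
move=> y1 z1; set u := sqrt1 y; set w := sqrt1 z.
have : `|1 + 1| <= `|u + w| + `|(u - 1) + (w - 1)|.
  have -> : (1 + 1 : K) = (u + w) - ((u - 1) + (w - 1)) by ring.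
  exact: ler_normB.
have : `|(u - 1) + (w - 1)| <= 1.
  apply: le_trans (ler_normD _ _) _; rewrite [leRHS](splitr 1) mul1r lerD//.
    exact: le_trans (sqrt1_dist _) (ltW y1).
  exact: le_trans (sqrt1_dist _) (ltW z1).
rewrite (normr_nat K 2) => h1 h2.
have := le_trans h2 (lerD (lexx _) h1).
by rewrite lerD2r.
Qed.

Lemma sqrt1_sub y z : sqrt1_dom y -> sqrt1_dom z ->
  sqrt1 y - sqrt1 z = (y - z) / (sqrt1 y + sqrt1 z).
Proof.
move=> y1 z1; have h : sqrt1 y + sqrt1 z != 0.
  by rewrite -normr_gt0; apply: lt_le_trans (sqrt1_add_ge1 y1 z1); exact: ltr01.
by apply: (canRL (mulfK h)); rewrite -subr_sqr !sqrt1_sqr.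
Qed.

Lemma open_sqrt1_dom z : sqrt1_dom z -> \forall y \near z, sqrt1_dom y.
Proof.
rewrite /sqrt1_dom /= => z1.
have e0 : 0 < 2^-1 - `|z - 1| by rewrite subr_gt0.
apply/nbhs_ballP; exists (2^-1 - `|z - 1|) => // y.
rewrite -ball_normE /= => yz.
have -> : y - 1 = (z - 1) - (z - y) by ring.
apply: le_lt_trans (ler_normB _ _) _.
by rewrite addrC -ltrBrDr.
Qed.

Lemma sqrt1_continuous z : sqrt1_dom z -> {for z, continuous sqrt1}.
Proof.
move=> z1; apply/(@cvgrPdist_lt _ _ _ (nbhs z)) => e e0; near=> y.
have y1 : sqrt1_dom y by near: y; exact: open_sqrt1_dom.
rewrite sqrt1_sub// normrM normfV.
apply: (@le_lt_trans _ _ `|z - y|).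
  by rewrite ler_piMr// invf_le1 ?sqrt1_add_ge1// (lt_le_trans ltr01)// sqrt1_add_ge1.
by near: y; exact: (@cvgr_dist_lt _ _ _ (nbhs z) _ id z).
Unshelve. all: by end_near. Qed.

Lemma differentiable_sqrt1 z : sqrt1_dom z -> differentiable (sqrt1 : K -> K) z.
Proof.
move=> z1; apply/derivable1_diffP; apply/cvg_ex.
exists (sqrt1 z + sqrt1 z)^-1.
have s0 : sqrt1 z + sqrt1 z != 0.
  by rewrite -mulr2n mulrn_eq0 /= sqrt1_neq0.
have h0z : h + z @[h --> (0 : K)] --> z.
  rewrite -[X in _ --> X]add0r.
  exact: (@cvgD K K^o K (nbhs (0 : K)) _ id (cst z) 0 z (@cvg_id _ _) (cvg_cst z)).
have S : (sqrt1 (h + z) + sqrt1 z)^-1 @[h --> (0 : K)^'] --> (sqrt1 z + sqrt1 z)^-1.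
  apply: cvgV => //; apply: cvgD; last exact: cvg_cst.
  apply: (cvg_trans _ (cvg_comp _ _ h0z (sqrt1_continuous z1))).
  by apply: cvg_app; exact: cvg_within.
apply: cvg_trans S; apply: near_eq_cvg; near=> h.
have h0 : h != 0 by near: h; exact: nbhs_dnbhs_neq.
have hz : sqrt1_dom (h + z).
  near: h; apply: cvg_within; exact: (h0z _ (open_sqrt1_dom z1)).
rewrite /= [h *: 1]mulr1 (sqrt1_sub hz z1) addrK -[LHS]/(_^-1) -[RHS]/(h^-1 * _).
by rewrite mulKf.
Unshelve. all: by end_near. Qed.

End SquareRoot.

Section Slice.
Variables (K : numClosedFieldType) (n' : nat).
Local Notation n := n'.+1.
Local Notation M := 'M[K]_n.
Variables (X0 : M).
Hypotheses (BX : bruhat_minus X0) (BXT : bruhat_minus X0^T).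

Let pivot_ex (i : 'I_n) : exists j, X0 i j != 0.
Proof.
case: (pickP (fun j => X0 i j != 0)) => [j Xj|h]; first by exists j.
have := bruhat_minus_unit BX; rewrite -row_free_unit => /row_freeP[B XB].
exfalso; case/eqP: (oner_neq0 K).
have /matrixP/(_ i i) := XB; rewrite !mxE eqxx mulr1n => <-.
by rewrite big1 // => j _; move/negbFE/eqP: (h j) => ->; rewrite mul0r.
Qed.

Definition pivot i : 'I_n := xchoose (pivot_ex i).

Lemma pivot_neq0 i : X0 i (pivot i) != 0.
Proof. exact: xchooseP (pivot_ex i). Qed.

(** The $n'$ coordinates of row $i$ fill the columns other than the pivot; the default 0 of [oapp]
    is the entry at the pivot itself. *)
Definition slice_dir (v : 'rV[K]_(n * n')) : M :=
  \matrix_(i, j) oapp (vec_mx v i) 0 (unlift (pivot i) j).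

Fact slice_dir_is_linear : linear slice_dir.
Proof.
move=> a u v; apply/matrixP=> i j; rewrite !mxE.
by case: unliftP => [k _|_] /=; rewrite ?linearP ?mxE//= mulr0 addr0.
Qed.
HB.instance Definition _ := GRing.isLinear.Build K 'rV[K]_(n * n') M *:%R
  slice_dir slice_dir_is_linear.

Lemma slice_dir_pivot v i : slice_dir v i (pivot i) = 0.
Proof. by rewrite mxE unlift_none. Qed.

Lemma slice_dir_eq0 v : slice_dir v = 0 -> v = 0.
Proof.
move=> /matrixP E; rewrite -[v]vec_mxK; apply/eqP; rewrite mxvec_eq0; apply/eqP/matrixP=> i j.
by have := E i (lift (pivot i) j); rewrite mxE liftK /= => ->; rewrite !mxE.
Qed.

Definition slice v : M := X0 + slice_dir v.

Lemma slice_pivot v i : slice v i (pivot i) = X0 i (pivot i).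
Proof. by rewrite mxE slice_dir_pivot addr0. Qed.

Lemma slice0 : slice 0 = X0.
Proof. by rewrite /slice raddf0 addr0. Qed.

Lemma slice_inj : injective slice.
Proof.
move=> u v /addrI E; apply/eqP; rewrite -subr_eq0; apply/eqP/slice_dir_eq0.
by rewrite raddfB /= E subrr.
Qed.

Lemma differentiable_slice v : differentiable slice v.
Proof.
by apply: differentiableD; [exact: differentiable_cst|exact: differentiable_linear_mx].
Qed.

Lemma diff_slice v w : 'd slice v w = slice_dir w.
Proof.
have e1 : 'd (cst X0) v w = 0 by rewrite diff_cst.
have e2 : 'd slice_dir v w = slice_dir w by rewrite (diff_linear_mx slice_dir).
have E : 'd slice v = 'd (cst X0) v \+ 'd slice_dir v :> (_ -> _).
  by apply: diffD; [exact: differentiable_cst|exact: differentiable_linear_mx].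
transitivity ('d (cst X0) v w + 'd slice_dir v w); first exact: (congr1 (fun g => g w) E).
transitivity (0 + slice_dir w); first exact: (congr2 +%R e1 e2).
exact: add0r.
Qed.

Definition ratio k v : K := ham_val n k X0 / ham_val n k (slice v).

(* The products of the first k diagonal entries of the torus element that
   moves slice v back to the common level set of the Casimirs. *)
Definition partial_weight k v : K :=
  if k == 0%N then 1 else if k == n then ratio n v else sqrt1 (ratio k v * ratio n v).

Definition weight v : 'rV[K]_n := \row_i (partial_weight i.+1 v / partial_weight i v).

Definition leaf_map v : M := diag_mx (weight v) *m slice v.

Definition slice_dom : set 'rV[K]_(n * n') := [set v |
  forall k, (k <= n)%N -> [/\ ham_num n k (slice v) != 0, ham_den n k (slice v) != 0
    & sqrt1_dom (ratio k v * ratio n v)]].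

Lemma ratio0 k : (k <= n)%N -> ratio k 0 = 1.
Proof. by move=> kn; rewrite /ratio slice0 divff// ham_val_neq0. Qed.

Lemma partial_weight0 k : (k <= n)%N -> partial_weight k 0 = 1.
Proof.
move=> kn; rewrite /partial_weight; case: eqP => // _; case: eqP => _; first exact: ratio0.
by rewrite !ratio0// mul1r sqrt1_1.
Qed.

Lemma leaf_map0 : leaf_map 0 = X0.
Proof.
rewrite /leaf_map slice0; apply/matrixP=> i j; rewrite mul_diag_mx !mxE.
by rewrite !partial_weight0 ?divr1 ?mul1r// ltnW.
Qed.

Lemma differentiable_ratio k v : ham_num n k (slice v) != 0 -> ham_den n k (slice v) != 0 ->
  differentiable (ratio k) v.
Proof.
move=> N0 D0; apply: differentiableM; first exact: differentiable_cst.
apply: differentiableV; last by rewrite mulf_neq0 ?invr_eq0.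
exact: (differentiable_comp (differentiable_slice v) (differentiable_ham_val D0)).
Qed.

Section InDomain.
Variable v : 'rV[K]_(n * n').
Hypothesis Dv : slice_dom v.

Lemma ham_val_slice_neq0 k : (k <= n)%N -> ham_val n k (slice v) != 0.
Proof. by move=> /Dv[N0 D0 _]; rewrite mulf_neq0 ?invr_eq0. Qed.

Lemma ratio_neq0 k : (k <= n)%N -> ratio k v != 0.
Proof. by move=> kn; rewrite mulf_neq0 ?invr_eq0 ?ham_val_slice_neq0 ?ham_val_neq0. Qed.

Lemma partial_weight_neq0 k : (k <= n)%N -> partial_weight k v != 0.
Proof.
move=> kn; rewrite /partial_weight; case: (k =P 0%N) => _; first exact: oner_neq0.
by case: (k =P n) => _; [exact: ratio_neq0|have [_ _] := Dv kn; exact: sqrt1_neq0].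
Qed.

Lemma differentiable_partial_weight k : (k <= n)%N -> differentiable (partial_weight k) v.
Proof.
move=> kn; rewrite /partial_weight; case: (k =P 0%N) => _; first exact: differentiable_cst.
have dr m : (m <= n)%N -> differentiable (ratio m) v.
  by move=> /Dv[N0 D0 _]; exact: differentiable_ratio.
case: (k =P n) => _; first exact: dr.
have [_ _ sd] := Dv kn.
have drr : differentiable (fun u => ratio k u * ratio n u) v by apply: differentiableM; exact: dr.
exact: (differentiable_comp drr (differentiable_sqrt1 sd)).
Qed.

Lemma differentiable_weight i : differentiable (fun u => weight u 0 i) v.
Proof.
have -> : (fun u => weight u 0 i) = (fun u => partial_weight i.+1 u / partial_weight i u).
  by apply/funext => u; rewrite mxE.
apply: differentiableM; first exact: differentiable_partial_weight.
by apply: differentiableV; [apply: differentiable_partial_weight|apply: partial_weight_neq0];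
  exact: ltnW.
Qed.

Lemma weight_neq0 i : weight v 0 i != 0.
Proof. by rewrite mxE mulf_neq0 ?invr_eq0 ?partial_weight_neq0// ltnW. Qed.

Lemma prod_weight p m : (p + m <= n)%N ->
  \prod_(i < m) weight v 0 (shift_ord n' p i) = partial_weight (p + m)%N v / partial_weight p v.
Proof.
elim: m => [|m IH] pm.
  have -> : (p + 0 = p)%N by lia.
  by rewrite big_ord0 divff// partial_weight_neq0//; lia.
rewrite big_ord_recr /= (eq_bigr (fun i => weight v 0 (shift_ord n' p i))) => [|i _]; last first.
  by congr (weight v 0 _); apply: ord_inj; rewrite !val_shift_ord//; lia.
rewrite IH; last by lia.
rewrite mxE val_shift_ord//= addnS.
have h1 : partial_weight p v != 0 by apply: partial_weight_neq0; lia.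
have h2 : partial_weight (p + m)%N v != 0 by apply: partial_weight_neq0; lia.
by field; rewrite h1 h2.
Qed.

Lemma ham_num_leaf_map k : (k <= n)%N ->
  ham_num n k (leaf_map v) = partial_weight k v * ham_num n k (slice v).
Proof.
by move=> kn; rewrite /ham_num solid_diag_mx prod_weight ?add0n// [partial_weight 0 v]/partial_weight eqxx divr1.
Qed.

Lemma ham_den_leaf_map k : (k <= n)%N -> ham_den n k (leaf_map v) =
  partial_weight n v / partial_weight k v * ham_den n k (slice v).
Proof.
by move=> kn; rewrite /ham_den solid_diag_mx prod_weight subnKC.
Qed.

(** With $T_k$ the product of the first $k$ weights, the numerator scales by $T_k$ and the
    denominator by $T_n/T_k$, so $H(n,k)$ scales by $T_k^2/T_n$. Requiring this to be [ratio k v]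
    gives $T_n$ directly for $k=n$ and needs a square root for the other $k$. *)
Lemma ham_val_leaf_map k : (1 <= k <= n)%N -> ham_val n k (leaf_map v) = ham_val n k X0.
Proof.
move=> /andP[k0 kn]; rewrite /ham_val ham_num_leaf_map// ham_den_leaf_map//.
have [N0 D0 _] := Dv kn; have wn := partial_weight_neq0 (leqnn n); have wk := partial_weight_neq0 kn.
transitivity (partial_weight k v ^+ 2 / partial_weight n v * ham_val n k (slice v)).
  by rewrite /ham_val; field; rewrite D0 wn wk.
have -> : partial_weight k v ^+ 2 / partial_weight n v = ratio k v; last first.
  by rewrite /ratio divfK// ham_val_slice_neq0.
rewrite /partial_weight (gtn_eqF k0) eqxx /=; have rn := ratio_neq0 (leqnn n).
by case: (k =P n) => [->|_]; [field|rewrite sqrt1_sqr mulfK].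
Qed.

Lemma leaf_map_cell : bruhat_minus (leaf_map v) /\ bruhat_minus (leaf_map v)^T.
Proof.
split; apply: solid_bruhat_minus => k kn.
  rewrite -/(ham_num n k) ham_num_leaf_map// mulf_neq0 ?partial_weight_neq0//.
  by have [] := Dv kn.
rewrite solid_tr; have := ham_den_leaf_map (leq_subr k n); rewrite /ham_den subKn// => ->.
rewrite !mulf_neq0 ?invr_eq0 ?partial_weight_neq0 ?leq_subr//.
by have [_ + _] := Dv (leq_subr k n); rewrite /ham_den subKn.
Qed.

Lemma differentiable_leaf_map : differentiable leaf_map v.
Proof.
apply: differentiable_mx => i j.
have -> : (fun u => leaf_map u i j) = (fun u => weight u 0 i * slice u i j).
  by apply/funext => u; rewrite /leaf_map mul_diag_mx mxE.
apply: differentiableM; first exact: differentiable_weight.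
exact: (differentiable_comp (differentiable_slice v) (@differentiable_coord K n n _ i j)).
Qed.

Lemma diff_leaf_map w i j : 'd leaf_map v w i j =
  weight v 0 i * slice_dir w i j + slice v i j * 'd (fun u => weight u 0 i) v w.
Proof.
rewrite (diff_mx w i j differentiable_leaf_map).
have -> : (fun u => leaf_map u i j : K) = (fun u => weight u 0 i) * (fun u => slice u i j).
  by apply/funext => u; rewrite /leaf_map mul_diag_mx mxE.
have dw := differentiable_weight i.
have ds : differentiable (fun u => slice u i j : K) v.
  exact: (differentiable_comp (differentiable_slice v) (@differentiable_coord K n n _ i j)).
have E := congr1 (fun g => g w) (diffM dw ds).
apply: (etrans E); rewrite -[LHS]/(weight v 0 i * 'd (fun u => slice u i j : K) v w +
  slice v i j * 'd (fun u => weight u 0 i) v w).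
by rewrite -(diff_mx w i j (differentiable_slice v)) diff_slice.
Qed.

(** The pivot entries of the slice are constant and nonzero, so in those positions only the weights
    vary; their differentials vanish on [w], and then [slice_dir w] does. The same recovery of the
    weights gives [leaf_map_inj]. *)
Lemma diff_leaf_map_eq0 w : 'd leaf_map v w = 0 -> w = 0.
Proof.
move=> /matrixP E; apply: slice_dir_eq0; apply/matrixP=> i j; rewrite [RHS]mxE.
have dw0 : 'd (fun u => weight u 0 i) v w = 0.
  have := E i (pivot i); rewrite diff_leaf_map slice_dir_pivot mulr0 add0r slice_pivot mxE.
  by move=> /eqP; rewrite mulf_eq0 (negPf (pivot_neq0 i)) /= => /eqP.
have := E i j; rewrite diff_leaf_map dw0 mulr0 addr0 [RHS]mxE => /eqP.
by rewrite mulf_eq0 (negPf (weight_neq0 i)) /= => /eqP.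
Qed.

Lemma near_slice_dom : \forall u \near v, slice_dom u.
Proof.
have dN k : differentiable (fun u => ham_num n k (slice u)) v.
  exact: (differentiable_comp (differentiable_slice v) (differentiable_solid _ _ _ _)).
have dD k : differentiable (fun u => ham_den n k (slice u)) v.
  exact: (differentiable_comp (differentiable_slice v) (differentiable_solid _ _ _ _)).
have FV : Filter (nbhs v) by exact: nbhs_filter.
have near1 (k : 'I_n.+1) : \forall u \near v, [/\ ham_num n k (slice u) != 0,
    ham_den n k (slice u) != 0 & sqrt1_dom (ratio k u * ratio n u)].
  have kn : (k <= n)%N by rewrite -ltnS.
  have [N0 D0 S0] := Dv kn; have [N1 D1 _] := Dv (leqnn n).
  have cN : \forall u \near v, ham_num n k (slice u) != 0.
    exact: (@cvgr_neq0 K K^o _ (nbhs v) _ _ _ (differentiable_continuous (dN k)) N0).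
  have cD : \forall u \near v, ham_den n k (slice u) != 0.
    exact: (@cvgr_neq0 K K^o _ (nbhs v) _ _ _ (differentiable_continuous (dD k)) D0).
  have dr : differentiable (fun u => ratio k u * ratio n u) v.
    by apply: differentiableM; exact: differentiable_ratio.
  have cr := (differentiable_continuous dr) _ (open_sqrt1_dom S0).
  exact: (@filterS3 _ (nbhs v) FV _ _ _ _ (fun u a b c => And3 a b c) cN cD cr).
have := filter_forall FV near1.
apply: (@filterS _ (nbhs v) FV) => u h k kn; have := h (inord k).
by rewrite inordK.
Qed.

End InDomain.

Lemma leaf_map_inj : {in slice_dom &, injective leaf_map}.
Proof.
move=> u v; rewrite !inE => Du Dv E.
have wE i : weight u 0 i = weight v 0 i.
  apply: (mulIf (pivot_neq0 i)).
  move/matrixP: E => /(_ i (pivot i)); rewrite /leaf_map !mul_diag_mx ![LHS]mxE ![RHS]mxE.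
  by rewrite !slice_pivot.
apply: slice_inj; apply/matrixP=> i j.
move/matrixP: E => /(_ i j); rewrite /leaf_map !mul_diag_mx [LHS]mxE [RHS]mxE wE.
exact: mulfI (weight_neq0 Dv i) _ _.
Qed.

(** The Casimirs are constant along [leaf_map], which gives one inclusion by
    [characteristic_casimir]; the differential is injective and $n n'=n^2-n$, so dimensions
    agree. *)
Lemma range_diff_leaf_map v : slice_dom v ->
  range ('d leaf_map v) = range (hamvec (leaf_map v)).
Proof.
move=> Dv; have [BY BYT] := leaf_map_cell Dv; have dphi := differentiable_leaf_map Dv.
have sub w : exists A, 'd leaf_map v w = hamvec (leaf_map v) A.
  apply: (characteristic_casimir BY BYT) => k kn.
  have kn' : (k <= n)%N by case/andP: kn.
  have D0 := ham_den_neq0 BYT kn'.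
  have dc := differentiable_ham_val D0.
  rewrite -cov_ham_val// -diff_cov//.
  transitivity ('d (@ham_val K n' n k \o leaf_map) v w).
    by rewrite (diff_comp dphi dc).
  rewrite -deriveE; last exact: differentiable_comp.
  rewrite (@near_eq_derive K _ K^o _ (cst (ham_val n k X0))) ?derive_cst//.
  apply: filterS (near_slice_dom Dv) => u Du.
  exact: ham_val_leaf_map.
pose g : {linear 'rV[K]_(n * n') -> M} := HB.pack ('d leaf_map v : _ -> M)
  (GRing.isLinear.Build K 'rV[K]_(n * n') M *:%R ('d leaf_map v : _ -> M)
     (fun a u w => linearP ('d leaf_map v) a u w)).
have gE w : linfun g w = 'd leaf_map v w by rewrite lfunE.
have ker0 : lker (linfun g) = 0%VS.
  apply/eqP; rewrite -subv0; apply/subvP => w; rewrite memv_ker gE memv0.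
  by move=> /eqP/(diff_leaf_map_eq0 Dv)->.
have [_ df] := limg_hamvec BY BYT.
have gf : limg (linfun g) = limg (linfun (hamvec (leaf_map v))).
  apply/eqP; rewrite eqEdim; apply/andP; split.
    apply/subvP => _ /memv_imgP[w _ ->]; rewrite gE; have [A ->] := sub w.
    by rewrite -[hamvec _ A](lfunE (hamvec (leaf_map v))) memv_img ?memvf.
  rewrite df; have := limg_ker_dim (linfun g) fullv.
  by rewrite ker0 capv0 dimv0 add0n dimvf /dim /= mul1n => ->; rewrite mulnS addKn.
apply/seteqP; split=> [_ [w _ <-]|_ [A _ <-]].
  by have [A ->] := sub w; exists A.
have : hamvec (leaf_map v) A \in limg (linfun g).
  by rewrite gf -[hamvec _ A](lfunE (hamvec (leaf_map v))) memv_img ?memvf.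
by move=> /memv_imgP[w _ ->]; exists w => //; rewrite gE.
Qed.

Lemma slice_dom0 : slice_dom 0.
Proof.
move=> k kn; rewrite slice0 !ratio0// mul1r; split; first exact: ham_num_neq0.
  exact: ham_den_neq0.
by rewrite /sqrt1_dom /= subrr normr0 invr_gt0 ltr0n.
Qed.

End Slice.

Lemma leaf_chart_ex (K : numClosedFieldType) n' (X0 : 'M[K]_n'.+1) :
  bruhat_minus X0 -> bruhat_minus X0^T ->
  exists (e : K) (V : set 'rV[K]_(n'.+1 * n')) (phi : 'rV[K]_(n'.+1 * n') -> 'M[K]_n'.+1),
    [/\ 0 < e, V = ball 0 e, phi 0 = X0, {in V &, injective phi}
      & forall v, V v -> [/\ differentiable phi v, injective ('d phi v),
          bruhat_minus (phi v), bruhat_minus (phi v)^T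
        & range ('d phi v) = range (hamvec (phi v))]].
Proof.
move=> BX BXT.
(* The domain is restricted to a ball, whose connectedness an integral chart will require. *)
have /nbhs_ballP[e e0 h] := near_slice_dom (slice_dom0 BX BXT).
exists e, (ball 0 e), (leaf_map BX); split=> //; first exact: leaf_map0.
  by move=> u v; rewrite !inE => /h Du /h Dv; apply: (leaf_map_inj BXT); rewrite inE.
move=> v /h Dv; have [BY BYT] := leaf_map_cell BXT Dv.
split=> //; first exact: (differentiable_leaf_map BXT).
  move=> u w E; apply/eqP; rewrite -subr_eq0; apply/eqP; apply: (diff_leaf_map_eq0 BXT Dv).
  by rewrite linearB /= E subrr.
exact: range_diff_leaf_map.
Qed.

(** * The leaves *)

Section TangentCharts.
Variables (K : numClosedFieldType) (n' d : nat).
Local Notation n := n'.+1.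
Variables (V : set 'rV[K]_d) (phi : 'rV[K]_d -> 'M[K]_n).
Hypothesis hV : tangent_chart V phi.

Lemma diff_casimir_on_chart k v : (k <= n)%N -> V v ->
  differentiable (@ham_val K n' n k \o phi) v /\
  'd (@ham_val K n' n k \o phi) v = 0 :> ('rV[K]_d -> K).
Proof.
move=> kn /hV.2[dphi BX BXT rng].
have D0 := ham_den_neq0 BXT kn.
have dc := differentiable_ham_val D0.
split; first exact: differentiable_comp.
apply/funext => w.
transitivity ('d (@ham_val K n' n k) (phi v) ('d phi v w)).
  by rewrite (diff_comp dphi dc).
rewrite diff_cov// cov_ham_val//.
have : range ('d phi v) ('d phi v w) by exists w.
by rewrite rng => -[A _ <-]; exact: mxtrace_casimir_hamvec.
Qed.

Lemma open_initial_minors_neq0 : open (V `&` [set v | initial_minors_neq0 (phi v)]).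
Proof.
rewrite openE => v [Vv good]; apply: filterI; first exact: open_nbhs_nbhs (conj hV.1 Vv).
have [dphi _ _ _] := hV.2 v Vv.
have FV : Filter (nbhs v) by exact: nbhs_filter.
have ds p q m : solid p q m (phi v) != 0 -> \forall u \near v, solid p q m (phi u) != 0.
  move=> s0; have ds : differentiable (fun u => solid p q m (phi u)) v.
    exact: (differentiable_comp dphi (differentiable_solid _ _ _ _)).
  exact: (@cvgr_neq0 K K^o _ (nbhs v) _ _ _ (differentiable_continuous ds) s0).
have near1 (i : 'I_n.+1 * 'I_n.+1) : \forall u \near v, (i.1 + i.2 <= n)%N ->
    solid 0 i.1 i.2 (phi u) != 0 /\ solid i.1 0 i.2 (phi u) != 0.
  case: i => p m /=; case: (boolP (p + m <= n)%N) => pm; last first.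
    exact: (@filterE _ (nbhs v) FV).
  have [s0 s1] := good p m pm.
  exact: (@filterS2 _ (nbhs v) FV _ _ _ (fun u a b _ => conj a b) (ds _ _ _ s0) (ds _ _ _ s1)).
have := filter_forall FV near1.
apply: (@filterS _ (nbhs v) FV) => u h p m pm; have := h (inord p, inord m).
by rewrite /= !inordK; [exact|lia|lia].
Qed.

End TangentCharts.

Lemma independent_eq_in (K : numClosedFieldType) (V W : normedModType K) (I : eqType)
    (s : seq I) (F G : I -> W -> K) (phi : V -> W) v :
  (forall p, p \in s -> F p = G p) ->
  (forall p, p \in s -> differentiable (F p \o phi) v) /\
  (forall c : I -> K, (forall w, \sum_(p <- s) c p * 'd (F p \o phi) v w = 0) ->
    forall p, p \in s -> c p = 0) ->
  (forall p, p \in s -> differentiable (G p \o phi) v) /\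
  (forall c : I -> K, (forall w, \sum_(p <- s) c p * 'd (G p \o phi) v w = 0) ->
    forall p, p \in s -> c p = 0).
Proof.
move=> FG [dF indep]; split=> [p ps|c hc]; first by rewrite -FG//; exact: dF.
apply: indep => w; rewrite -[RHS](hc w) big_seq [RHS]big_seq.
by apply: eq_bigr => p ps; rewrite FG.
Qed.

Lemma clos_rst_invariant T S (r : T -> T -> Prop) (f : T -> S) x y :
  (forall x y, r x y -> f y = f x) -> clos_refl_sym_trans T r x y -> f y = f x.
Proof. by move=> rf; elim=> {x y} [x y /rf|x|x y _ ->|x y z _ <- _ ->]. Qed.

Section Leaves.
Variables (R : realType) (n' : nat).
Local Notation n := n'.+1.
Local Notation C := (C R).
Local Notation M := 'M[C]_n.
Local Notation cell := (@open_double_bruhat_cell C n).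

Lemma integral_chart_tangent d (V : set 'rV[C]_d) (phi : 'rV[C]_d -> M) :
  integral_chart cell V phi -> tangent_chart V phi.
Proof.
move=> [oV _ sub _ hV]; split=> // v Vv; have [dphi _ rng] := hV v Vv.
have /open_double_bruhat_cellE[B BT] : cell (phi v) by apply: sub; exists v.
by split=> //; rewrite -characteristicE.
Qed.

Lemma ham_const_chart k X Y : (1 <= k <= n)%N -> in_common_chart cell X Y ->
  @ham C n (n, k) X = @ham C n (n, k) Y.
Proof.
move=> kn [d [V [phi [chart [u Vu <-] [v Vv <-]]]]].
rewrite (hamE R kn (leqnn n)).
have kn' : (k <= n)%N by case/andP: kn.
have [oV cV _ _ _] := chart.
have D w Vw := @diff_casimir_on_chart C n' d V phi (integral_chart_tangent chart) k w kn' Vw.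
exact: (complex_eq_of_diff_eq0 oV cV D Vu Vv).
Qed.

Lemma in_common_chart_cell X Y : in_common_chart cell X Y -> cell X /\ cell Y.
Proof. by move=> [d [V [phi [[_ _ sub _ _] /sub cX /sub cY]]]]. Qed.

Lemma leaf_sub_cell X Y :
  clos_refl_sym_trans M (in_common_chart cell) X Y -> (cell X <-> cell Y).
Proof. by elim=> [x y /in_common_chart_cell[]||x y _ []|x y z _ [h1 h2] _ [h3 h4]]//; tauto. Qed.

Lemma symplectic_leaf_cell L : symplectic_leaf cell L -> L `<=` cell.
Proof. by move=> [X cX ->] Y /= /leaf_sub_cell[h _]; exact: h. Qed.

Lemma ham_const_leaf k L : (1 <= k <= n)%N -> symplectic_leaf cell L ->
  exists c, forall X, L X -> @ham C n (n, k) X = c.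
Proof.
move=> kn [X _ ->]; exists (@ham C n (n, k) X) => Y /= XY.
exact: clos_rst_invariant (fun x y h => esym (ham_const_chart kn h)) XY.
Qed.

Lemma leaf_dim_cell L : symplectic_leaf cell L -> leaf_dim cell L (n * n').
Proof.
move=> leafL X LX; have /open_double_bruhat_cellE[B BT] := symplectic_leaf_cell leafL LX.
have [e [V [phi [e0 VE phi0 inj hV]]]] := leaf_chart_ex B BT.
have V0 : V 0 by rewrite VE; exact: ballxx.
have chart : integral_chart cell V phi.
  split=> //.
  - by rewrite VE; exact: ball_open.
  - by rewrite VE; exact: complex_ball_connected.
  - by move=> _ [v Vv <-]; have [_ _ BX BXT _] := hV v Vv; apply/open_double_bruhat_cellE.
  - by move=> v Vv; have [dphi inj' _ _ rng] := hV v Vv; split=> //; rewrite characteristicE.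
exists V, phi; split; last by exists 0.
(* Every point of the chart shares it with [X], so one more step in the chain keeps the whole chart
   in the leaf. *)
split=> // _ [v Vv <-]; case: leafL LX => X1 _ -> /= X1X.
apply: rst_trans X1X _; apply: rst_step; exists (n * n')%N, V, phi; split=> //; first by exists 0.
Qed.

Lemma ham_independent_leaf L : symplectic_leaf cell L ->
  functionally_independent cell L (ham_index n') (@ham_dom C n) (@ham C n).
Proof.
(* On this locus all denominators are nonzero too, so the Hamiltonians are defined there. *)
move=> leafL; exists (L `&` [set X | initial_minors_neq0 X]); split.
- split=> [X []//|d V phi [chart sub]].
  rewrite (_ : _ `&` _ = V `&` [set v | initial_minors_neq0 (phi v)]).
    exact: open_initial_minors_neq0 (integral_chart_tangent chart).
  by apply/seteqP; split=> v [Vv] => [[]//|h]; split=> //; split=> //; apply: sub; exists v.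
- move=> d V phi [chart sub] W oW WV W0.
  have [v [Wv h]] := initial_minors_neq0_on_chart (integral_chart_tangent chart) oW WV W0.
  by exists v; split=> //; split=> //; apply: sub; exists v => //; exact: WV.
move=> X [LX good]; split=> [[l k]|d V phi v [chart _] Vv E].
  rewrite ham_indexP => /= /andP[kl ln]; apply/(ham_dom_den X kl (leqW ln)).
  by have [] := good k (l - k)%N ltac:(lia).
rewrite -E in good.
apply: independent_eq_in (ham_independent_on_chart (integral_chart_tangent chart) Vv good).
by case=> m p; rewrite ham_indexP => /andP[pm mn]; apply/esym/hamE => //; exact: leqW.
Qed.

End Leaves.

Theorem mainTheorem5 (R : realType) (n : nat) (n_gt0 : (0 < n)%N) :
  let cell : set 'M[C R]_n := @open_double_bruhat_cell (C R) n in
  let H : nat * nat -> 'M[C R]_n -> C R := @ham (C R) n in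
  let dom : nat * nat -> set 'M[C R]_n := @ham_dom (C R) n in
  [/\ (* the Hamiltonians pairwise Poisson commute *)
      forall p q, p \in ham_index n -> q \in ham_index n ->
        forall X, dom p X -> dom q X -> bracket (H p) (H q) X = 0,
      (* those with l = n are Casimirs on the cell, constant on the leaves *)
      forall k, (1 <= k <= n)%N ->
        [/\ cell `<=` dom (n, k),
            casimir cell (H (n, k))
          & forall L, symplectic_leaf cell L ->
              exists c, forall X, L X -> H (n, k) X = c],
      (* those with l < n are n(n-1)/2 many and independent on each leaf *)
      size (ham_index n.-1) = (n * n.-1)./2 /\
      forall L, symplectic_leaf cell L ->
        functionally_independent cell L (ham_index n.-1) dom H
    & (* the dimension of the leaves *)
      forall L, symplectic_leaf cell L -> leaf_dim cell L (n * n.-1)].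
Proof.
case: n n_gt0 => // n' _ cell H dom; split.
- by move=> p q ps qs X dp dq; exact: bracket_ham.
- move=> k kn; have kn' : (k <= n'.+1)%N by case/andP: kn.
  split; last by move=> L; exact: ham_const_leaf.
  + move=> X /open_double_bruhat_cellE[_ BT].
    by apply/(ham_dom_den X kn (leqnn _)); exact: ham_den_neq0.
  + exact: casimir_ham.
- by split; [rewrite size_ham_index|exact: ham_independent_leaf].
- exact: leaf_dim_cell.
Qed.
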